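(* Let $\mathbb{P}_2$ be the set of semi-primes and let $\mathrm{cpx}_{\mathbf{1}_{\mathbb{P}_2}}(n)$ be the complexity of the subshift $X_{\mathbf{1}_{\mathbb{P}_2}}$ generated by its indicator. Then, as $n\to\infty$, $$\mathrm{cpx}_{\mathbf{1}_{\mathbb{P}_2}}(n)\ll (4+o(1))^{\frac{23\,n\,(\log\log n)^2}{\log (4)\,\log n}}.$$ If Dickson's conjecture is true then, as $n\to\infty$, $$(2+o(1))^{\frac{n\log\log n}{2\log n}}\ll \mathrm{cpx}_{\mathbf{1}_{\mathbb{P}_2}}(n).$$
   Context: $\log$ is the natural logarithm. $\mathbb{P}_2=\{n\in\mathbb{Z}: \Omega(n)=2\}$, where $\Omega(n)$ is the number of prime divisors of $|n|$ counted with multiplicity (so $\mathbb{P}_2$ is symmetric and consists of $\pm pq$ with $p,q$ primes, possibly equal). $S$ is the left shift on $\{0,1\}^{\mathbb{Z}}$; for $y\in\{0,1\}^{\mathbb{Z}}$, $X_y:=\overline{\{S^jy: j\in\mathbb{Z}\}}$ and $\mathrm{cpx}_y(n)$ is the number of distinct blocks of length $n$ appearing in elements of $X_y$. $f(n)\ll (c+o(1))^{g(n)}$ means: there are a constant $C>0$ and a sequence $\varepsilon_n\to0$ with $f(n)\le C(c+\varepsilon_n)^{g(n)}$ for all sufficiently large $n$; similarly $(c+o(1))^{g(n)}\ll f(n)$ means $f(n)\ge C(c+\varepsilon_n)^{g(n)}$ for some $C>0$, $\varepsilon_n\to0$ and all sufficiently large $n$. Dickson's conjecture: let $\Phi=\{f_i(x)=a_i+b_ix: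 i=1,\ldots,k\}$ be a finite family of linear polynomials with $a_i,b_i\in\mathbb{Z}$, $b_i\ge1$. If for every prime $p$ there is $y\in\mathbb{Z}$ with $\prod_{i=1}^k f_i(y)\not\equiv0 \bmod p$, then there are infinitely many natural numbers $m$ such that $f_1(m),\ldots,f_k(m)$ are all primes. *)

(* Defs.v *)
From mathcomp Require Import all_boot all_order all_algebra.
From mathcomp Require Import all_classical all_reals all_analysis.

Set Implicit Arguments.
Unset Strict Implicit.
Unset Printing Implicit Defensive.

Import Order.TTheory GRing.Theory Num.Theory.
Import numFieldNormedType.Exports.

Local Open Scope classical_set_scope.
Local Open Scope ring_scope.

(* [bool] carries the discrete topology, so this is the product topology. *)
Notation full_shift := (prod_topology (fun _ : int => bool)).

(* [shift_pow j] is the [j]-th iterate of the left shift [shift_pow 1]. *)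
Definition shift_pow (j : int) (y : full_shift) : full_shift := fun i => y (i + j).

Definition orbit_closure (y : full_shift) : set full_shift :=
  closure (range (shift_pow ^~ y)).

Definition block_appears_in n (w : n.-tuple bool) (x : full_shift) : Prop :=
  exists j : int, forall i : 'I_n, tnth w i = x (j + i%:Z).

Definition cpx (y : full_shift) (n : nat) : nat :=
  #|[pred w : n.-tuple bool
      | `[< exists2 x, orbit_closure y x & block_appears_in w x >] ]|.

(* [prime_decomp 0] is empty, so [Omega 0 = 0] and 0 is not a semiprime. *)
Definition Omega (m : int) : nat := (\sum_(f <- prime_decomp `|m|%N) f.2)%N.

Definition semiprimes : set int := [set m | Omega m = 2%N].

Definition indicator (A : set int) : full_shift := fun m => `[< A m >].

(* [f n << (c + o(1)) ^ (g n)] as [n] tends to infinity. The base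
   [c + e n] is eventually positive for [c > 0], where [powR] is the usual
   real power. *)
Definition ll_oexp (R : realType) (f : nat -> R) (c : R) (g : nat -> R) : Prop :=
  exists2 C : R, 0 < C &
  exists2 e : nat -> R, e @ \oo --> (0 : R) &
    \forall n \near \oo, f n <= C * (c + e n) `^ (g n).

(* [(c + o(1)) ^ (g n) << f n] as [n] tends to infinity. *)
Definition oexp_ll (R : realType) (c : R) (g : nat -> R) (f : nat -> R) : Prop :=
  exists2 C : R, 0 < C &
  exists2 e : nat -> R, e @ \oo --> (0 : R) &
    \forall n \near \oo, C * (c + e n) `^ (g n) <= f n.

Definition Dickson_conjecture : Prop :=
  forall (k : nat) (a b : 'I_k -> int),
    (forall i, 1 <= b i) ->
    (forall p : nat, prime p ->
       exists y : int, ~ (p%:Z %| \prod_(i < k) (a i + b i * y))%Z) ->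
    infinite_set [set m : nat | forall i,
      exists2 q : nat, prime q & a i + b i * m%:Z = q%:Z].

(* Main.v *)
(** Upper bound. Put Y = exp (ln n / (7 ln ln n + 3)). Apart from the at most
    4n + 1 words read near 0, every word of length n is supported on the set of
    positions i at which at most one prime p <= Y divides a + i, where a is the
    position modulo Y`!. A truncated sieve bounds the size of such a set by
    29 n (ln ln n)^2 / ln n, so there are at most Y`! times 2 to that power far
    words, and 29 ln 2 < 23 leaves room for the other terms.

    Lower bound. Let z and w be powers of 2 close to n^(19/20) and n^(1/40).
    Among the numbers pq < n with p <= w and q > z prime there are at least
    (3/5) n (ln ln n - O(1)) / ln n by Chebyshev and Mertens type bounds.
    Discarding, for each prime q in (z, n], the sparsest class modulo q loses at
    most an eighth of them and leaves a set T. Given U included in T, Dickson's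
    conjecture makes (s + pq) / p prime for all pq in U and for a shift s that is
    also chosen, by the Chinese remainder theorem, to make s + i divisible by the
    cube of a prime for i in T outside U: hence all 2^|T| patterns on T occur. *)

Require Import Defs.
From mathcomp Require Import all_boot all_order all_algebra.
From mathcomp Require Import all_classical all_reals all_analysis.
From mathcomp Require Import zify ring lra.

Import Order.TTheory GRing.Theory Num.Theory.
Import numFieldNormedType.Exports.

Set Implicit Arguments.
Unset Strict Implicit.
Unset Printing Implicit Defensive.

Local Open Scope classical_set_scope.
Local Open Scope ring_scope.

(** * Lists of primes in an interval, and products of distinct primes *)

Definition primes_in (a b : nat) : seq nat := [seq p <- index_iota a.+1 b.+1 | prime p].

Lemma mem_primes_in a b p : (p \in primes_in a b) = [&& (a < p)%N, (p <= b)%N & prime p].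
Proof. by rewrite mem_filter mem_index_iota ltnS andbC andbA. Qed.

Lemma primes_in_uniq a b : uniq (primes_in a b).
Proof. exact/filter_uniq/iota_uniq. Qed.

Lemma primes_in_prime a b : {in primes_in a b, forall p, prime p}.
Proof. by move=> p; rewrite mem_primes_in => /and3P[]. Qed.

Lemma primes_in_cat a b c : (a <= b)%N -> (b <= c)%N ->
  primes_in a c = primes_in a b ++ primes_in b c.
Proof.
move=> ab bc; rewrite /primes_in -filter_cat /index_iota !subSS.
have -> : (c - a = (b - a) + (c - b))%N by lia.
by rewrite iotaD; have -> : (a.+1 + (b - a) = b.+1)%N by lia.
Qed.

Lemma size_primes_in a b : (size (primes_in a b) <= b - a)%N.
Proof. by rewrite size_filter (leq_trans (count_size _ _)) // size_iota subSS. Qed.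

Lemma size_primes_le b : (0 < b)%N -> (size (primes_in 0 b) < b)%N.
Proof.
move=> b0; rewrite (@primes_in_cat 0 1 b) // size_cat.
have -> : size (primes_in 0 1) = 0%N by [].
by rewrite add0n; have := size_primes_in 1 b; lia.
Qed.

Lemma prod_primes_dvd (s : seq nat) N : uniq s -> {in s, forall p, prime p} ->
  {in s, forall p, (p %| N)%N} -> ((\prod_(p <- s) p) %| N)%N.
Proof.
elim: s => [|p s IHs] /=; first by rewrite big_nil dvd1n.
move=> /andP[ps us] pr dv; rewrite big_cons Gauss_dvd.
  rewrite dv ?mem_head // IHs // => q qs; [apply: pr | apply: dv]; by rewrite inE qs orbT.
rewrite big_seq; apply: (big_rec (coprime p)) => [|q b qs cb]; first exact: coprimen1.
rewrite coprimeMr cb andbT prime_coprime ?pr ?mem_head // dvdn_prime2 ?pr ?mem_head ?inE ?qs ?orbT //.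
by apply: contra ps => /eqP ->.
Qed.

(** * Chebyshev bounds from the central binomial coefficient *)

Lemma central_bin_le m : ('C(m.*2, m) <= 4 ^ m)%N.
Proof.
have -> : (4 ^ m = (1 + 1) ^ m.*2)%N by rewrite -mul2n expnM.
rewrite expnDn.
have mlt : (m < m.*2.+1)%N by rewrite -addnn; lia.
rewrite (bigD1 (Ordinal mlt)) //= !exp1n !muln1; exact: leq_addr.
Qed.

Lemma central_binS m : (m.+1 * 'C(m.+1.*2, m.+1) = (m.*2.+1).*2 * 'C(m.*2, m))%N.
Proof.
have e1 := mul_bin_diag m.*2.+2 m.
have e2 := mul_bin_diag m.*2.+1 m.
have e3 := mul_bin_left m.*2.+1 m.
have e4 : (m.*2.+1 - m = m.+1)%N by lia.
rewrite e4 in e3; rewrite /= in e1 e2; rewrite doubleS.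
nia.
Qed.

Lemma central_bin_ge m : (0 < m)%N -> (4 ^ m <= m.*2 * 'C(m.*2, m))%N.
Proof.
elim: m => // -[|m] IHm _; first by [].
have {IHm} := IHm isT; have := central_binS m.+1.
rewrite (expnS _ m.+1) -(mul2n m.+2) -mulnA => -> h.
apply: (@leq_trans (4 * (m.+1.*2 * 'C(m.+1.*2, m.+1)))); first by rewrite leq_mul2l h.
by rewrite !mulnA leq_mul2r; apply/orP; right; lia.
Qed.

Lemma prime_dvd_fact_le p m : prime p -> (p %| m`!)%N -> (p <= m)%N.
Proof.
move=> pp; elim: m => [|m IHm]; first by rewrite dvdn1 => /eqP p1; rewrite p1 in pp.
by rewrite factS Euclid_dvdM // => /orP[/dvdn_leq -> //|/IHm /leqW].
Qed.

Lemma leq_prod_seq (I : eqType) (s : seq I) (F G : I -> nat) :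
  {in s, forall i, F i <= G i}%N -> (\prod_(i <- s) F i <= \prod_(i <- s) G i)%N.
Proof.
move=> FG; rewrite big_seq [leqRHS]big_seq.
by apply: (big_ind2 (fun x y => x <= y)%N) => // *; exact: leq_mul.
Qed.

Lemma prod_const_seq (I : Type) (s : seq I) c : (\prod_(i <- s) c = c ^ size s)%N.
Proof. by rewrite big_const_seq count_predT iter_muln_1. Qed.

(** A prime in (m, 2m] divides (2m)! but not m!, hence divides the central binomial coefficient. So
    the product of these primes, each larger than m, is at most 4^m. *)
Lemma size_primes_doubling m : (m ^ size (primes_in m m.*2) <= 4 ^ m)%N.
Proof.
apply: leq_trans (central_bin_le m).
apply: (@leq_trans (\prod_(p <- primes_in m m.*2) p)%N).
  rewrite -prod_const_seq; apply: leq_prod_seq => p.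
  by rewrite mem_primes_in => /and3P[/ltnW].
apply: dvdn_leq; first by rewrite bin_gt0 -addnn leq_addr.
apply: prod_primes_dvd; [exact: primes_in_uniq|exact: primes_in_prime|].
move=> p; rewrite mem_primes_in => /and3P[mp p2 pp].
have mm : (m <= m.*2)%N by lia.
have := bin_fact mm; have -> : (m.*2 - m = m)%N by lia.
move=> E; have : (p %| m.*2`!)%N by rewrite dvdn_fact // prime_gt0.
rewrite -E !Euclid_dvdM //.
by case/orP => // /orP[] /(prime_dvd_fact_le pp); lia.
Qed.

(** The Chebyshev upper bound at m = 2^k, where both sides are powers of 2 and it suffices to
    compare exponents. *)
Lemma size_primes_dyadic k :
  (k * size (primes_in (2 ^ k) (2 ^ k.+1)) <= 2 ^ k.+1)%N.
Proof.
have := size_primes_doubling (2 ^ k).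
have -> : (2 ^ k).*2 = (2 ^ k.+1)%N by rewrite expnS mul2n.
have -> : (4 ^ (2 ^ k) = 2 ^ (2 ^ k.+1))%N by rewrite (expnS _ k) [RHS]expnM.
by rewrite -expnM leq_exp2l.
Qed.

(** By Legendre's formula the valuation is the sum over k of floor(2m / p^k) - 2 floor(m / p^k).
    Each term is 0 or 1, and it vanishes once p^k > 2m. *)
Lemma prime_power_central_bin p m : prime p -> (0 < m)%N ->
  (p ^ logn p 'C(m.*2, m) <= m.*2)%N.
Proof.
move=> pp m0.
have mm : (m <= m.*2)%N by lia.
have b0 : (0 < 'C(m.*2, m))%N by rewrite bin_gt0.
have E := congr1 (logn p) (bin_fact mm).
have e : (m.*2 - m = m)%N by lia.
rewrite e !lognM ?fact_gt0 ?muln_gt0 ?fact_gt0 // in E.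
(* Legendre's sum for m! is padded with zero terms so that it has the same range as the one for
   (2m)!. *)
have E1 : logn p m`! = (\sum_(1 <= k < m.*2.+1) m %/ p ^ k)%N.
  rewrite logn_fact // [RHS](@big_cat_nat _ _ _ m.+1) //= ?ltnS //.
  rewrite [X in (_ = _ + X)%N]big_nat [X in (_ = _ + X)%N]big1 ?addn0 // => k /andP[mk _].
  rewrite divn_small //; apply: (leq_trans mk).
  exact/ltnW/ltn_expl/prime_gt1.
rewrite !E1 logn_fact // in E.
set t := trunc_log p m.*2.
have pt : (p ^ t <= m.*2)%N by apply: trunc_logP; [exact: prime_gt1|lia].
apply: (leq_trans _ pt); apply: leq_pexp2l; first exact: prime_gt0.
suff : (\sum_(1 <= k < m.*2.+1) m.*2 %/ p ^ k <=
  t + 2 * \sum_(1 <= k < m.*2.+1) m %/ p ^ k)%N by lia.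
have tm : (t <= m.*2)%N.
  by apply/ltnW/(leq_trans _ pt)/ltn_expl/prime_gt1.
apply: (@leq_trans (\sum_(1 <= k < m.*2.+1) ((k <= t) + 2 * (m %/ p ^ k)))%N).
  rewrite big_nat [leqRHS]big_nat; apply: leq_sum => k /andP[k1 _].
  have pk : (0 < p ^ k)%N by rewrite expn_gt0 prime_gt0.
  have [kt|tk] := leqP k t.
    have : (m.*2 %/ p ^ k < 2 + 2 * (m %/ p ^ k))%N.
      rewrite ltn_divLR //; have := divn_eq m (p ^ k); have := ltn_pmod m pk.
      by nia.
    by rewrite add1n add2n ltnS.
  rewrite divn_small //.
  have := trunc_log_ltn m.*2 (prime_gt1 pp); rewrite -/t => h.
  by apply: (leq_trans h); apply: leq_pexp2l => //; exact: prime_gt0.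
rewrite big_split /= -big_distrr /= leq_add2r.
rewrite (@big_cat_nat _ _ _ t.+1) //= ?ltnS //.
rewrite [X in (_ + X)%N]big_nat [X in (_ + X)%N]big1 ?addn0; last first.
  by move=> k /andP[tk _]; rewrite leqNgt tk.
apply: (@leq_trans (\sum_(1 <= k < t.+1) 1)%N).
  by apply: leq_sum => k _; apply: leq_b1.
by rewrite sum_nat_const_nat; lia.
Qed.

Lemma central_bin_le_primes m : (0 < m)%N ->
  ('C(m.*2, m) <= m.*2 ^ size (primes_in 0 m.*2))%N.
Proof.
move=> m0.
have mm : (m <= m.*2)%N by lia.
have b0 : (0 < 'C(m.*2, m))%N by rewrite bin_gt0.
rewrite {1}(prod_prime_decomp b0) prime_decompE big_map /=.
have sub : {subset primes 'C(m.*2, m) <= primes_in 0 m.*2}.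
  move=> p; rewrite mem_primes mem_primes_in => /and3P[pp _ pC].
  rewrite pp (prime_gt0 pp) andbT; apply: prime_dvd_fact_le => //.
  by rewrite -(bin_fact mm) dvdn_mulr.
apply: leq_trans (leq_pexp2l _ (uniq_leq_size (primes_uniq _) sub)); last by lia.
rewrite -prod_const_seq; apply: leq_prod_seq => p.
by rewrite mem_primes => /and3P[pp _ _]; exact: prime_power_central_bin.
Qed.

(** The Chebyshev lower bound, from 4^m <= 2m C(2m, m) with m = floor(x / 2). The extra factor x
    pays for 2m, and the exponent x - 1 covers odd x. *)
Lemma size_primes_ge x : (2 <= x)%N ->
  (2 ^ x.-1 <= x ^ (size (primes_in 0 x)).+1)%N.
Proof.
move=> x2; set m := x./2.
have m0 : (0 < m)%N by rewrite /m; lia.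
have mx : (m.*2 <= x)%N by rewrite /m; lia.
apply: (@leq_trans (4 ^ m)).
  have -> : (4 ^ m = 2 ^ m.*2)%N by rewrite -mul2n expnM.
  by rewrite leq_exp2l // /m; lia.
apply: leq_trans (central_bin_ge m0) _.
rewrite expnS; apply: leq_mul => //.
apply: leq_trans (central_bin_le_primes m0) _.
apply: (@leq_trans (x ^ size (primes_in 0 m.*2))); first by case: (size _) => // k; rewrite leq_exp2r.
apply: leq_pexp2l; first lia.
by rewrite (@primes_in_cat 0 m.*2 x) // size_cat leq_addr.
Qed.

(** * A truncated sieve on an interval, with an added divisibility condition *)

Definition sifted (n a d : nat) (s : seq nat) : nat :=
  count (fun i => (d %| a + i)%N && all (fun p => ~~ (p %| a + i)%N) s) (iota 0 n).

Lemma count_split (T : Type) (P Q S : pred T) (s : seq T) :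
  (forall x, P x + Q x = S x)%N -> (count P s + count Q s = count S s)%N.
Proof. by move=> PQS; elim: s => //= x s <-; rewrite -PQS addnACA. Qed.

(** The Legendre identity: positions counted without the condition at p split according to whether p
    divides them, and coprimality merges the conditions d and p into d p. *)
Lemma sifted_cons n a d p s : coprime p d ->
  (sifted n a d (p :: s) + sifted n a (d * p) s = sifted n a d s)%N.
Proof.
move=> cpd; apply: count_split => i /=.
by rewrite Gauss_dvd 1?coprime_sym //; case: (d %| _)%N => //=; case: (p %| _)%N; case: all.
Qed.

Lemma leq_sifted n a d s : (sifted n a d s <= sifted n a d [::])%N.
Proof. by apply: sub_count => i /= /andP[->]. Qed.

(** The number of multiples of d below a is the ceiling of a / d, written (a + d - 1) / d; the
    difference of two such counts is stated additively to avoid truncated subtraction. *)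
Lemma sifted_nil n a d : (0 < d)%N ->
  (sifted n a d [::] + (a + d.-1) %/ d = (a + d.-1 + n) %/ d)%N.
Proof.
move=> d0; elim: n => [|n IHn]; first by rewrite addn0.
rewrite addnS divnS // -IHn /sifted -addn1 iotaD count_cat /= add0n !andbT addn0.
have -> : (a + d.-1 + n).+1 = (d + (a + n))%N by lia.
by rewrite (dvdn_addr _ (dvdnn d)) -addnA addnCA.
Qed.

Lemma sifted_nil_bound (R : realType) n a d : (0 < d)%N ->
  `|(sifted n a d [::])%:R - n%:R / d%:R| <= 1 :> R.
Proof.
move=> d0; have := sifted_nil n a d0; set b := (a + d.-1)%N; set c := sifted _ _ _ _ => E.
have d0' : 0 < d%:R :> R by rewrite ltr0n.
have h1 := divn_eq b d; have h2 := divn_eq (b + n) d.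
have h3 := ltn_pmod b d0; have h4 := ltn_pmod (b + n) d0.
rewrite -E in h2.
have -> : c%:R - n%:R / d%:R = (c%:R * d%:R - n%:R) / d%:R :> R by field; rewrite gt_eqF.
rewrite normrM normfV [`|d%:R|]gtr0_norm // ler_pdivrMr // mul1r.
have : (c * d + (b + n) %% d = n + b %% d)%N by nia.
move/(congr1 (fun x => x%:R : R)); rewrite !natrD natrM => F.
have -> : c%:R * d%:R - n%:R = (b %% d)%:R - ((b + n) %% d)%:R :> R by lra.
move: h3 h4; rewrite -(ltr_nat R) -(ltr_nat R) => h3 h4.
by rewrite ler_norml; have := ler0n R (b %% d); have := ler0n R ((b+n) %% d); lra.
Qed.

Definition euler_prod (R : realType) (s : seq nat) : R := \prod_(p <- s) (1 - p%:R^-1).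

Definition recip_sum (R : realType) (s : seq nat) : R := \sum_(p <- s) p%:R^-1.

Lemma euler_prod_cons (R : realType) p s :
  euler_prod R (p :: s) = (1 - p%:R^-1) * euler_prod R s.
Proof. exact: big_cons. Qed.

Lemma recip_sum_cons (R : realType) p s :
  recip_sum R (p :: s) = p%:R^-1 + recip_sum R s.
Proof. exact: big_cons. Qed.

Lemma recip_sum_cat (R : realType) s t :
  recip_sum R (s ++ t) = recip_sum R s + recip_sum R t.
Proof. exact: big_cat. Qed.

Lemma recip_sum_ge0 (R : realType) s : 0 <= recip_sum R s.
Proof. by apply: sumr_ge0 => p _; rewrite invr_ge0. Qed.

Lemma prime_inv_bounds (R : realType) p : prime p ->
  0 < p%:R^-1 :> R /\ p%:R^-1 <= 2^-1 :> R.
Proof.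
move=> /prime_gt1 p1; split; first by rewrite invr_gt0 ltr0n; lia.
by rewrite lef_pV2 ?ler_nat // posrE ltr0n; lia.
Qed.

Lemma euler_prod_bounds (R : realType) s : {in s, forall p, prime p} ->
  0 < euler_prod R s <= 1.
Proof.
elim: s => [|p s IHs] pr; first by rewrite /euler_prod big_nil ltr01 lexx.
have /andP[e0 e1] : 0 < euler_prod R s <= 1 by apply: IHs => q qs; apply: pr; rewrite inE qs orbT.
have [i0 i1] := prime_inv_bounds R (pr p (mem_head _ _)).
by rewrite euler_prod_cons; nra.
Qed.

(** The first two terms of the binomial expansion; this is what lets the two error terms of the
    sieve recursion recombine into one. *)
Lemma exprDl_bernoulli (R : realType) (x y : R) r : 0 <= x -> 0 <= y ->
  y ^+ r.+1 + r.+1%:R * x * y ^+ r <= (x + y) ^+ r.+1.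
Proof.
move=> x0 y0; elim: r => [|r IHr]; first by rewrite !expr1 expr0; lra.
rewrite exprS [leRHS]exprS (mulrDl x).
have yr0 : 0 <= y ^+ r by apply: exprn_ge0.
have h : y ^+ r.+1 <= (x + y) ^+ r.+1 by rewrite lerXn2r ?nnegrE ?addr_ge0 // lerDr.
have := ler_wpM2l y0 IHr; have := ler_wpM2l x0 h.
by rewrite exprS -[r.+2%:R]natr1; move: (y ^+ r) => t; move: ((x + y) ^+ r.+1) => u; nra.
Qed.

(* Recursion on the Legendre identity, stopped at depth [r]; unlike Brun's
   alternating version no parity of [r] matters. *)
Lemma brun_pure_sieve (R : realType) n a r s d :
  uniq s -> {in s, forall p, prime p} -> (0 < d)%N -> {in s, forall p, coprime p d} ->
  `|(sifted n a d s)%:R - n%:R / d%:R * euler_prod R s| <=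
    (size s).+1%:R ^+ r + n%:R / d%:R * (recip_sum R s ^+ r / r`!%:R).
Proof.
elim: s r d => [|p s IHs] r d us prs d0 cs.
  rewrite /euler_prod big_nil mulr1 expr1n.
  apply: le_trans (sifted_nil_bound R n a d0) _.
  by rewrite lerDl mulr_ge0 ?divr_ge0 // exprn_ge0 // recip_sum_ge0.
have nd0 : 0 <= n%:R / d%:R :> R by rewrite divr_ge0.
(* At depth 0 the claimed error is 1 + n/d, which is trivial: the count lies between 0 and n/d + 1,
   and the main term between 0 and n/d. *)
case: r => [|r].
  have := leq_sifted n a d (p :: s); have := sifted_nil_bound R n a d0.
  rewrite -(ler_nat R) ler_norml => /andP[_ h1] h2.
  have /andP[e0 e1] := euler_prod_bounds R prs.
  rewrite !expr0 divr1 mulr1 ler_norml.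
  have := ler0n R (sifted n a d (p :: s)).
  have := mulr_ge0 nd0 (ltW e0); have := ler_wpM2l nd0 e1; rewrite mulr1.
  by move: (n%:R / d%:R * _) => t; lra.
have pp : prime p by apply: prs; rewrite mem_head.
have prs' : {in s, forall q, prime q} by move=> q qs; apply: prs; rewrite inE qs orbT.
move: us => /= /andP[ps us].
have cpd : coprime p d by apply: cs; rewrite mem_head.
have cs' : {in s, forall q, coprime q d} by move=> q qs; apply: cs; rewrite inE qs orbT.
have h1 := IHs r.+1 d us prs' d0 cs'.
have dp0 : (0 < d * p)%N by rewrite muln_gt0 d0 prime_gt0.
have cdp : {in s, forall q, coprime q (d * p)}.
  move=> q qs; rewrite coprimeMr (cs' q qs) /= prime_coprime ?dvdn_prime2 ?(prs' q qs) //.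
  by apply: contra ps => /eqP <-.
have h2 := IHs r (d * p)%N us prs' dp0 cdp.
have /(congr1 (fun x => x%:R : R)) := sifted_cons n a s cpd; rewrite natrD => E.
have dp : n%:R / (d * p)%:R = n%:R / d%:R * p%:R^-1 :> R.
  by rewrite natrM invfM mulrA.
rewrite dp in h2; rewrite euler_prod_cons recip_sum_cons /=.
have k0 : 0 <= (size s).+1%:R :> R by [].
have -> : (size s).+2%:R = 1 + (size s).+1%:R :> R by rewrite [RHS]addrC natr1.
(* [K] and [F] add up the errors of the two recursive calls, of depth r + 1 for d and depth r for d
   p, to the error for [p :: s]. *)
have K : (size s).+1%:R ^+ r.+1 + (size s).+1%:R ^+ r <= (1 + (size s).+1%:R) ^+ r.+1 :> R.
  apply: le_trans (exprDl_bernoulli r ler01 k0); rewrite lerD2l mulr1 ler_peMl ?exprn_ge0 //.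
  by rewrite ler1n.
have p0 : 0 <= p%:R^-1 :> R by rewrite invr_ge0.
have S := exprDl_bernoulli r p0 (recip_sum_ge0 R s).
have F : recip_sum R s ^+ r.+1 / r.+1`!%:R + p%:R^-1 * (recip_sum R s ^+ r / r`!%:R) <=
         (p%:R^-1 + recip_sum R s) ^+ r.+1 / r.+1`!%:R.
  have f0 : 0 < r`!%:R :> R by rewrite ltr0n fact_gt0.
  have f1 : 0 < r.+1%:R :> R by rewrite ltr0n.
  rewrite factS natrM ler_pdivlMr ?mulr_gt0 //.
  apply: le_trans S; rewrite le_eqVlt; apply/orP; left; apply/eqP.
  move: (r`!%:R) (r.+1%:R) f0 f1 => f g f0 g0.
  by field; rewrite !gt_eqF // ltr0n prime_gt0.
have G := ler_wpM2l nd0 F; rewrite mulrDr in G.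
have -> : (sifted n a d (p :: s))%:R - n%:R / d%:R * ((1 - p%:R^-1) * euler_prod R s) =
  ((sifted n a d s)%:R - n%:R / d%:R * euler_prod R s) -
  ((sifted n a (d * p) s)%:R - n%:R / d%:R * p%:R^-1 * euler_prod R s) :> R.
  by rewrite -E; ring.
apply: le_trans (ler_normB _ _) _; apply: le_trans (lerD h1 h2) _.
rewrite -(mulrA (n%:R / d%:R) p%:R^-1).
move: (_ / r.+1`!%:R) (_ / r`!%:R) (_ / r.+1`!%:R) G K => u v w G K.
by lra.
Qed.

(** * Mertens type bounds for Euler products and sums of reciprocals of primes *)

Lemma sum_multiples (R : realType) (F : nat -> R) p N : (0 < p)%N ->
  \sum_(1 <= m < N.+1 | (p %| m)%N) F m = \sum_(1 <= k < (N %/ p).+1) F (p * k)%N.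
Proof.
move=> p0; elim: N => [|N IHN]; first by rewrite div0n !big_geq.
rewrite big_mkcond big_nat_recr //= -big_mkcond /= IHN divnS //.
case: ifP => pN; last by rewrite addr0 add0n.
rewrite add1n [RHS]big_nat_recr //=; congr (_ + F _).
by rewrite mulnC -[LHS](divnK pN) divnS // pN add1n.
Qed.

Definition smooth (s : seq nat) (m : nat) : bool := all (mem s) (primes m).

(** The truncation at N of the Dirichlet expansion of the inverse Euler product over s. *)
Definition smooth_sum (R : realType) (s : seq nat) (N : nat) : R :=
  \sum_(1 <= m < N.+1 | smooth s m) m%:R^-1.

Lemma smooth_sum_nil (R : realType) N : smooth_sum R [::] N <= 1.
Proof.
rewrite /smooth_sum; case: N => [|N]; first by rewrite big_geq.
rewrite big_ltn_cond // /smooth /= invr1 big_nat_cond big1 ?addr0 // => m.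
move=> /andP[/andP[m2 _]]; have : pdiv m \in primes m.
  by rewrite mem_primes pdiv_prime // pdiv_dvd; lia.
by case: (primes m).
Qed.

(** The terms not divisible by p are smooth over s alone; the multiples p k contribute 1/p times a
    sum over smooth k <= N / p, which is at most 1/p times the full sum. *)
Lemma smooth_sum_cons (R : realType) p s N : prime p ->
  smooth_sum R (p :: s) N * (1 - p%:R^-1) <= smooth_sum R s N.
Proof.
move=> pp; have p0 := prime_gt0 pp.
have pi0 : 0 <= p%:R^-1 :> R by rewrite invr_ge0.
rewrite mulrBr mulr1 lerBlDr {1}/smooth_sum (bigID (fun m => (p %| m)%N)) /= addrC.
apply: lerD.
  rewrite /smooth_sum big_mkcond [leRHS]big_mkcond big_nat [leRHS]big_nat.
  apply: ler_sum => m /andP[m1 _]; case: ifP => [/andP[sm npm]|_].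
    rewrite ifT //; apply/allP => q qm; have := allP sm q qm; rewrite !inE.
    by case/orP => // /eqP qp; move: qm npm; rewrite qp mem_primes => /and3P[_ _ ->].
  by case: ifP => _ //; rewrite invr_ge0.
under eq_bigl do rewrite andbC.
rewrite big_mkcondr /= (sum_multiples (fun m => if smooth (p :: s) m then m%:R^-1 else 0)) //.
rewrite /smooth_sum mulrC big_distrr /= [leRHS]big_mkcond /=.
rewrite [leRHS](@big_cat_nat _ _ _ (N %/ p).+1) //= ?ltnS ?leq_div //.
rewrite -[leLHS]addr0; apply: lerD; last first.
  by apply: sumr_ge0 => m _; case: ifP => // _; rewrite mulr_ge0 // invr_ge0.
rewrite big_nat [leRHS]big_nat; apply: ler_sum => m /andP[m1 _].
case: ifP => [sm|_]; last by case: ifP => // _; rewrite mulr_ge0 // invr_ge0.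
rewrite ifT ?natrM ?invfM //; apply/allP => q qm; apply: (allP sm).
by move: qm; rewrite !mem_primes muln_gt0 p0 => /and3P[-> -> qm] /=; rewrite dvdn_mull.
Qed.

Lemma euler_prod_smooth_sum (R : realType) s N : {in s, forall p, prime p} ->
  smooth_sum R s N * euler_prod R s <= 1.
Proof.
elim: s => [|p s IHs] prs; first by rewrite /euler_prod big_nil mulr1 smooth_sum_nil.
have prs' : {in s, forall q, prime q} by move=> q qs; apply: prs; rewrite inE qs orbT.
apply: le_trans (IHs prs'); rewrite euler_prod_cons mulrA.
apply: ler_wpM2r; first by have /andP[/ltW] := euler_prod_bounds R prs'.
by apply: smooth_sum_cons; apply: prs; rewrite mem_head.
Qed.

Lemma ln_le_harmonic (R : realType) N : ln N.+1%:R <= \sum_(1 <= m < N.+1) m%:R^-1 :> R.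
Proof.
elim: N => [|N IHN]; first by rewrite ln1 big_geq.
rewrite big_nat_recr //=; apply: le_trans (lerD IHN (lexx _)).
have n0 : 0 < N.+1%:R :> R by rewrite ltr0n.
have -> : N.+2%:R = N.+1%:R * (1 + N.+1%:R^-1) :> R.
  by rewrite mulrDr mulr1 divff ?gt_eqF // natr1.
have i0 : 0 < N.+1%:R^-1 :> R by rewrite invr_gt0.
rewrite lnM ?posrE ?addr_gt0 // lerD2l; apply: le_ln1Dx.
by rewrite (lt_trans _ i0) // ltrN10.
Qed.

(** Every positive m <= N is smooth over the primes up to N, so the truncated expansion is a full
    harmonic sum. *)
Lemma euler_prod_ln (R : realType) N :
  euler_prod R (primes_in 0 N) * ln N.+1%:R <= 1.
Proof.
have pr := @primes_in_prime 0 N.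
apply: le_trans (euler_prod_smooth_sum R N pr); rewrite mulrC.
apply: ler_wpM2r; first by have /andP[/ltW] := euler_prod_bounds R pr.
apply: le_trans (ln_le_harmonic R N) _; rewrite /smooth_sum [leRHS]big_mkcond /=.
rewrite big_nat [leRHS]big_nat; apply: ler_sum => m /andP[m1 mN].
rewrite ifT //; apply/allP => q; rewrite mem_primes inE mem_primes_in => /and3P[qp _ qm].
by rewrite prime_gt0 // qp andbT (leq_trans (dvdn_leq m1 qm)).
Qed.

(** The differences 1/(p - 1) - 1/p, extended from primes to all integers m >= 2, telescope to at
    most 1. *)
Lemma recip_sum_pred_le (R : realType) N :
  \sum_(p <- primes_in 0 N) (p%:R - 1)^-1 <= recip_sum R (primes_in 0 N) + 1.
Proof.
rewrite -lerBlDl /recip_sum -sumrB /primes_in big_filter.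
case: N => [|N]; first by rewrite big_geq.
have tele : \sum_(2 <= m < N.+2) (m.-1%:R^-1 - m%:R^-1) <= 1 :> R.
  apply: (@le_trans _ _ (1 - N.+1%:R^-1)); last by rewrite gerBl invr_ge0.
  rewrite le_eqVlt; apply/orP; left; apply/eqP.
  elim: N => [|N IHN]; first by rewrite big_geq // invr1 subrr.
  by rewrite big_nat_recr //= IHN addrA subrK.
apply: le_trans tele; rewrite big_ltn_cond //= big_mkcond.
rewrite big_nat [leRHS]big_nat; apply: ler_sum => m /andP[m2 _].
have m1 : m%:R - 1 = m.-1%:R :> R by rewrite -[in LHS](prednK (ltnW m2)) -natr1 addrK.
case: ifP => _; first by rewrite m1.
by rewrite subr_ge0 lef_pV2 ?ler_nat ?posrE ?ltr0n; lia.
Qed.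

(** Since 1/(1 - 1/p) = 1 + 1/(p - 1) <= exp(1/(p - 1)), [euler_prod_ln] bounds ln ln(N + 1) by the
    sum of 1/(p - 1); passing from p - 1 to p costs 1. *)
Lemma recip_sum_primes_ge (R : realType) N : (2 <= N)%N ->
  ln (ln N.+1%:R) - 1 <= recip_sum R (primes_in 0 N).
Proof.
move=> N2; have lnN : 0 < ln N.+1%:R :> R by rewrite ln_gt0 // ltr1n; lia.
rewrite lerBlDr; apply: le_trans (recip_sum_pred_le R N).
rewrite -ler_expR lnK ?posrE //.
set S := \sum_(p <- _) _.
have eV : expR (- S) <= euler_prod R (primes_in 0 N).
  rewrite /S /euler_prod -sumrN expR_sum big_seq [leRHS]big_seq.
  apply: ler_prod => p pN; rewrite expR_ge0 /=.
  have p1 : 0 < p%:R - 1 :> R by rewrite subr_gt0 ltr1n prime_gt1 // (primes_in_prime pN).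
  have -> : 1 - p%:R^-1 = (1 + (p%:R - 1)^-1)^-1 :> R.
    by field; rewrite ?gt_eqF //; lra.
  rewrite expRN lef_pV2 ?posrE ?expR_gt0 ?expR_ge1Dx //.
  by have : 0 < (p%:R - 1)^-1 :> R by [rewrite invr_gt0 //]; lra.
have := euler_prod_ln R N.
have e0 := expR_gt0 (- S).
move=> h; rewrite -[S]opprK expRN -[leRHS]mul1r ler_pdivlMr //.
by apply: le_trans h; rewrite mulrC ler_wpM2r // ltW.
Qed.

(** The block (2^k, 2^(k+1)] holds at most 2^(k+1) / k primes, each with reciprocal at most
    2^(-k). *)
Lemma recip_sum_dyadic (R : realType) a b : (0 < a)%N -> (a <= b)%N ->
  recip_sum R (primes_in (2 ^ a) (2 ^ b)) <= \sum_(a <= k < b) 2 / k%:R.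
Proof.
move=> a0; elim: b => [|b IHb]; first by rewrite leqn0 => /eqP ->; rewrite big_geq // /primes_in /index_iota subnn /recip_sum big_nil.
rewrite leq_eqVlt => /orP[/eqP <-|].
  by rewrite big_geq // /primes_in /index_iota subnn /recip_sum big_nil.
rewrite ltnS => ab; rewrite big_nat_recr //=.
rewrite (@primes_in_cat _ (2 ^ b)%N) ?leq_exp2l // recip_sum_cat.
apply: lerD; first exact: IHb.
have b0 : 0 < b%:R :> R by rewrite ltr0n; lia.
have pb0 : 0 < (2 ^ b)%:R :> R by rewrite ltr0n expn_gt0.
apply: (@le_trans _ _ (\sum_(p <- primes_in (2 ^ b) (2 ^ b.+1)) (2 ^ b)%:R^-1)).
  rewrite /recip_sum big_seq [leRHS]big_seq; apply: ler_sum => p.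
  rewrite mem_primes_in => /and3P[pb _ pp].
  by rewrite lef_pV2 ?posrE ?ltr0n ?expn_gt0 ?prime_gt0 // ler_nat ltnW.
rewrite big_const_seq count_predT iter_addr_0 -[leLHS]mulr_natl ler_pdivlMr // mulrAC.
rewrite ler_pdivrMr // mulrC -natrM -(natrM R 2) ler_nat -expnS.
exact: size_primes_dyadic.
Qed.

Lemma inv_le_ln (R : realType) k : (0 < k)%N -> k.+1%:R^-1 <= ln k.+1%:R - ln k%:R :> R.
Proof.
move=> k0; have k0' : 0 < k%:R :> R by rewrite ltr0n.
have k1' : 0 < k.+1%:R :> R by rewrite ltr0n.
rewrite -ln_div ?posrE // -[_ / _]invrK lnV ?posrE ?invr_gt0 ?divr_gt0 // lerNr invf_div.
have -> : k%:R / k.+1%:R = 1 + - k.+1%:R^-1 :> R.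
  by rewrite -[k.+1%:R]natr1 in k1' *; field; rewrite gt_eqF.
by apply: le_ln1Dx; rewrite ltrN2 invf_lt1 ?ltr1n.
Qed.

Lemma harmonic_le_ln (R : realType) K :
  \sum_(1 <= k < K.+2) k%:R^-1 <= 1 + ln K.+1%:R :> R.
Proof.
elim: K => [|K IHK]; first by rewrite big_nat1 invr1 ln1 addr0.
rewrite big_nat_recr //=; apply: le_trans (lerD IHK (inv_le_ln R (ltn0Sn K))) _.
by lra.
Qed.

Lemma recip_sum_primes_le (R : realType) K : (0 < K)%N ->
  recip_sum R (primes_in 0 (2 ^ K)) <= 5 / 2 + 2 * ln K%:R.
Proof.
move=> K0.
rewrite (@primes_in_cat 0 (2 ^ 1)%N) ?leq_exp2l // recip_sum_cat.
(* The prime 2 accounts for 1/2 of the constant 5/2; the other 2 comes from the bound 1 + ln K on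
   the harmonic sum, doubled. *)
have -> : recip_sum R (primes_in 0 (2 ^ 1)) = 2^-1 by rewrite /recip_sum /= big_seq1.
apply: (@le_trans _ _ (2^-1 + \sum_(1 <= k < K) 2 / k%:R)).
  by rewrite lerD2l recip_sum_dyadic.
rewrite -big_distrr /=.
have h : \sum_(1 <= k < K) k%:R^-1 <= 1 + ln K%:R :> R.
  case: K K0 => // -[|K] _; first by rewrite big_geq // ln1 addr0.
  apply: le_trans (harmonic_le_ln R K) _.
  by rewrite lerD2l ler_ln ?posrE ?ltr0n // ler_nat.
lra.
Qed.

(** * Sieve bound for integers divisible by at most one prime of a list *)

(** Follows from exp(-1) >= (1 - 1/6)^6 > 1/3. *)
Lemma expR1_le3 (R : realType) : expR 1 <= 3 :> R.
Proof.
have h : 1 - 6^-1 <= expR (- 6^-1) :> R by exact: expR_ge1Dx.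
have -> : 1 = 6%:R * 6^-1 :> R by rewrite divff.
rewrite expRM_natl -[expR _]invrK -expRN.
have h6 : (5 / 6 : R) ^+ 6 <= (expR (- 6^-1)) ^+ 6.
  rewrite lerXn2r ?nnegrE ?expR_ge0 //; apply: le_trans h; lra.
rewrite exprVn; apply: (@le_trans _ _ ((5 / 6 : R) ^+ 6)^-1).
  by rewrite lef_pV2 ?posrE // exprn_gt0 ?expR_gt0.
lra.
Qed.

(** (e x)^r / r! is a single term of the series of exp(e x), and e <= 3. The sieve remainder thus
    decays exponentially in the depth r. *)
Lemma exp_series_tail (R : realType) (x : R) r : 0 <= x ->
  x ^+ r / r`!%:R <= expR (3 * x - r%:R).
Proof.
move=> x0.
have f0 : 0 < r`!%:R :> R by rewrite ltr0n fact_gt0.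
have e1 := expR_gt0 (1 : R).
have H : (expR 1 * x) ^+ r / r`!%:R <= expR (expR 1 * x).
  have ex : 0 <= expR 1 * x by rewrite mulr_ge0 ?expR_ge0.
  case: r f0 => [|r] f0; first by rewrite expr0 fact0 divr1 -[leLHS]expR0 ler_expR.
  by apply: le_trans (expR_ge1Dxn r ex); rewrite lerDr.
rewrite expRD; apply: (@le_trans _ _ (expR (expR 1 * x) * expR (- r%:R))); last first.
  by rewrite ler_wpM2r ?expR_ge0 // ler_expR ler_wpM2r // expR1_le3.
rewrite expRN ler_pdivlMr ?expR_gt0 //; apply: le_trans H.
rewrite -[r%:R]mulr1 expRM_natl exprMn.
by rewrite le_eqVlt; apply/orP; left; apply/eqP; ring.
Qed.

Definition few_divisors (s : seq nat) (m : nat) : bool :=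
  (count (fun p => p %| m)%N s <= 1)%N.

(** Either no prime of s divides m, or exactly one p does and m survives the sieve by the others.
    The condition that 1 divides m is there to match [sifted] at d = 1. *)
Lemma few_divisors_split s m : uniq s ->
  (few_divisors s m <= ((1 %| m)%N && all (fun p => ~~ (p %| m)%N) s) +
    \sum_(p <- s) ((p %| m)%N && all (fun q => ~~ (q %| m)%N) (rem p s)))%N.
Proof.
move=> us; rewrite /few_divisors dvd1n /=.
case: (leqP (count (fun p => p %| m)%N s) 1) => // c1.
have [/hasP[p ps pm]|] := boolP (has (fun p => p %| m)%N s); last first.
  rewrite -all_predC => H; set b := all _ s; have -> : b = true by exact: H.
  exact: leq_addr.
rewrite (big_rem p ps) /= pm.
suff -> : all (fun q => ~~ (q %| m)%N) (rem p s) by rewrite addnCA leq_addr.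
rewrite -[all _ _]/(all (predC (fun q => q %| m)%N) _) all_predC has_count -leqNgt.
by have := permP (perm_to_rem ps) (fun q => q %| m)%N; move: c1 => /=; rewrite pm; lia.
Qed.

Lemma count_few_divisors n a s : uniq s ->
  (count (fun i => few_divisors s (a + i)) (iota 0 n) <=
    sifted n a 1 s + \sum_(p <- s) sifted n a p (rem p s))%N.
Proof.
move=> us.
have cE (P : pred nat) : count P (iota 0 n) = (\sum_(i <- iota 0 n) P i)%N.
  by rewrite -sum1_count big_mkcond; apply: eq_bigr => i _; case: ifP.
rewrite /sifted; under [X in (_ <= _ + X)%N]eq_bigr do rewrite cE.
rewrite !cE exchange_big -big_split /=; apply: leq_sum => i _.
exact: few_divisors_split.
Qed.

Lemma few_divisors_bound (R : realType) n a s r : uniq s -> {in s, forall p, prime p} ->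
  (count (fun i => few_divisors s (a + i)) (iota 0 n))%:R <=
    n%:R * euler_prod R s * (1 + 2 * recip_sum R s) + (size s).+1%:R ^+ r.+1 +
    n%:R * (1 + recip_sum R s) * expR (3 * recip_sum R s - r%:R).
Proof.
move=> us prs; set V := euler_prod R s; set S := recip_sum R s; set E := expR _.
have S0 : 0 <= S := recip_sum_ge0 R s.
have /andP[V0 V1] : 0 < V <= 1 := euler_prod_bounds R prs.
have n0 : 0 <= n%:R :> R by [].
apply: (@le_trans _ _ ((sifted n a 1 s)%:R + \sum_(p <- s) (sifted n a p (rem p s))%:R)).
  by rewrite -natr_sum -natrD ler_nat count_few_divisors.
have h1 : (sifted n a 1 s)%:R <= n%:R * V + (size s).+1%:R ^+ r + n%:R * E.
  have := brun_pure_sieve R n a r us prs (ltn0Sn 0) (fun p _ => coprimen1 p).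
  rewrite divr1 ler_norml => /andP[_ h].
  have := ler_wpM2l n0 (exp_series_tail r S0); rewrite -/E -/V -/S in h *; lra.
have h2 p : p \in s -> (sifted n a p (rem p s))%:R <=
    p%:R^-1 * (n%:R * (2 * V + E)) + (size s).+1%:R ^+ r.
  move=> ps; have pp := prs p ps.
  have prr : {in rem p s, forall q, prime q} by move=> q /mem_rem; exact: prs.
  have cpr : {in rem p s, forall q, coprime q p}.
    move=> q; rewrite (mem_rem_uniq _ us) !inE => /andP[qp /prs qpr].
    by rewrite prime_coprime // dvdn_prime2.
  have := brun_pure_sieve R n a r (rem_uniq _ us) prr (prime_gt0 pp) cpr.
  rewrite ler_norml => /andP[_ h].
  have [i0 i2] := prime_inv_bounds R pp.
  have VE : V = (1 - p%:R^-1) * euler_prod R (rem p s) by rewrite /V /euler_prod (big_rem p ps).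
  have SE : S = p%:R^-1 + recip_sum R (rem p s) by rewrite /S /recip_sum (big_rem p ps).
  have /andP[v0 _] := euler_prod_bounds R prr.
  (* Removing p from the product divides it by 1 - 1/p >= 1/2; this is the source of the factor 2
     before [recip_sum]. *)
  have v2 : euler_prod R (rem p s) <= 2 * V by nra.
  have s0 := recip_sum_ge0 R (rem p s).
  have e2 : recip_sum R (rem p s) ^+ r / r`!%:R <= E.
    apply: le_trans (exp_series_tail r s0) _; rewrite ler_expR lerD2r ler_wpM2l //.
    by rewrite SE lerDr ltW.
  have z : (size (rem p s)).+1%:R ^+ r <= (size s).+1%:R ^+ r :> R.
    by apply: lerXn2r; rewrite ?nnegrE ?ler0n // ler_nat ltnS size_rem // leq_pred.
  have np : 0 <= n%:R / p%:R :> R by rewrite mulr_ge0 // ltW.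
  have w1 := ler_wpM2l np v2; have w2 := ler_wpM2l np e2.
  have -> : p%:R^-1 * (n%:R * (2 * V + E)) = n%:R / p%:R * (2 * V) + n%:R / p%:R * E by ring.
  lra.
have h3 : \sum_(p <- s) (sifted n a p (rem p s))%:R <=
    S * (n%:R * (2 * V + E)) + (size s)%:R * (size s).+1%:R ^+ r.
  rewrite /S /recip_sum mulr_suml.
  have -> : (size s)%:R * (size s).+1%:R ^+ r = \sum_(p <- s) (size s).+1%:R ^+ r :> R.
    by rewrite mulr_natl big_const_seq count_predT iter_addr_0.
  by rewrite -big_split /= big_seq [leRHS]big_seq; apply: ler_sum.
have -> : (size s).+1%:R ^+ r.+1 = (size s)%:R * (size s).+1%:R ^+ r + (size s).+1%:R ^+ r :> R.
  by rewrite exprS -[X in X * _ = _]natr1 mulrDl mul1r.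
apply: le_trans (lerD h1 h3) _; rewrite le_eqVlt; apply/orP; left; apply/eqP; ring.
Qed.

(** * The number of prime factors, and semiprimes beyond Y^2 *)

Definition bigomega (m : nat) : nat := (\sum_(f <- prime_decomp m) f.2)%N.

(** A common summation range for all m <= N makes additivity a termwise statement about
    valuations. *)
Lemma bigomegaE m N : (m <= N)%N -> (bigomega m = \sum_(q < N.+1) logn q m)%N.
Proof.
move=> mN; rewrite /bigomega prime_decompE big_map /=.
rewrite -(big_mkord predT (fun q => logn q m)) [RHS](bigID (fun q => q \in primes m)) /=.
rewrite [X in _ = (_ + X)%N]big1 ?addn0 => [|q]; last first.
  by move=> qm; apply/eqP; rewrite -leqn0 leqNgt logn_gt0.
rewrite -[RHS]big_filter; apply: perm_big; apply: uniq_perm.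
- exact: primes_uniq.
- exact/filter_uniq/iota_uniq.
move=> q; rewrite mem_filter mem_index_iota /=.
case qm : (q \in primes m) => //=; move: qm; rewrite mem_primes ltnS.
by case/and3P => _ m0 /(dvdn_leq m0) /leq_trans ->.
Qed.

Lemma bigomegaM m1 m2 : (0 < m1)%N -> (0 < m2)%N ->
  bigomega (m1 * m2) = (bigomega m1 + bigomega m2)%N.
Proof.
move=> m10 m20; rewrite (bigomegaE (leqnn _)).
rewrite (@bigomegaE m1 (m1 * m2)) ?leq_pmulr // (@bigomegaE m2 (m1 * m2)) ?leq_pmull //.
by rewrite -big_split; apply: eq_bigr => q _; rewrite lognM.
Qed.

Lemma bigomega_prime p : prime p -> bigomega p = 1%N.
Proof.
move=> pp; rewrite /bigomega prime_decompE primes_prime // big_seq1 /=.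
by rewrite -[in LHS](expn1 p) pfactorK.
Qed.

Lemma bigomega_gt0 m : (1 < m)%N -> (0 < bigomega m)%N.
Proof.
move=> m1; have pp := pdiv_prime m1; have /dvdnP[k mE] := pdiv_dvd m.
move: (pdiv m) pp mE => p pp mE.
have k0 : (0 < k)%N by case: k mE m1 => // ->.
by rewrite mE bigomegaM // ?(bigomega_prime pp) ?addn1 // prime_gt0.
Qed.

Lemma semiprimesE m : semiprimes m <-> bigomega `|m|%N = 2%N.
Proof. by []. Qed.

(** If distinct primes p, q <= Y divide m, then m = k p q, and p q <= Y^2 < m forces k > 1, hence a
    third prime factor. *)
Lemma semiprime_few_divisors Y m : (Y ^ 2 < m)%N -> bigomega m = 2%N ->
  few_divisors (primes_in 0 Y) m.
Proof.
move=> Ym om; rewrite /few_divisors leqNgt; apply/negP; rewrite -size_filter.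
set s := (X in (1 < size X)%N) => s2.
have us : uniq s := filter_uniq _ (primes_in_uniq 0 Y).
have xs i : (i < size s)%N -> [/\ nth 0%N s i %| m, prime (nth 0%N s i) & nth 0%N s i <= Y]%N.
  move=> /(mem_nth 0%N); rewrite mem_filter mem_primes_in => /andP[pm /and3P[_ pY pp]].
  by split.
have [pm pp pY] := xs 0%N (ltnW s2); have [qm qp qY] := xs 1%N s2.
set p := nth 0%N s 0 in pm pp pY; set q := nth 0%N s 1 in qm qp qY.
have pq : p != q by rewrite /p /q nth_uniq // ltnW.
have : (p * q %| m)%N.
  by rewrite Gauss_dvd ?pm // prime_coprime // dvdn_prime2.
case/dvdnP => k mE.
have k1 : (1 < k)%N.
  rewrite ltnNge; apply/negP => k1; move: Ym; rewrite mE ltnNge => /negP; apply.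
  by rewrite -[leqRHS]mul1n leq_mul // -mulnn leq_mul.
have k0 := ltnW k1; have p0 := prime_gt0 pp; have q0 := prime_gt0 qp.
move: om; rewrite mE !bigomegaM ?muln_gt0 ?p0 //.
by rewrite (bigomega_prime pp) (bigomega_prime qp); have := bigomega_gt0 k1; lia.
Qed.

(** * Counting words of the subshift from above *)

Definition word (y : full_shift) (n : nat) (j : int) : n.-tuple bool :=
  [tuple y (j + i%:Z) | i < n].

(** Prescribing finitely many coordinates is an open condition, so a block of a limit point already
    occurs in y. *)
Lemma closure_block (y : full_shift) n (w : n.-tuple bool) x :
  orbit_closure y x -> block_appears_in w x -> exists j, w = word y n j.
Proof.
move=> yx [j wj].
have N : nbhs x [set z : full_shift | forall i : 'I_n, z (j + i%:Z) = x (j + i%:Z)].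
  apply: (@filter_forall _ _ (fun (i : 'I_n) (z : full_shift) => z (j + i%:Z) = x (j + i%:Z)) (nbhs x)) => i.
  have := @proj_continuous _ (fun _ : int => bool) (j + i%:Z) x.
  by move=> /(_ [set x (j + i%:Z)]) /=; apply; exact: discrete_set1.
have [_ [[k _ <-] /= xk]] := yx _ N.
exists (j + k); apply: eq_from_tnth => i; rewrite wj -xk tnth_mktuple /shift_pow.
by congr y; lia.
Qed.

Lemma card_words_supported n (A : {set 'I_n}) :
  (#|[set w : n.-tuple bool | [set i | tnth w i]%SET \subset A]%SET| <= 2 ^ #|A|)%N.
Proof.
pose f (w : n.-tuple bool) : {set 'I_n} := [set i | tnth w i]%SET.
have f_inj : injective f.
  by move=> w1 w2 /setP E; apply: eq_from_tnth => i; have := E i; rewrite !inE.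
rewrite -card_powerset -(card_imset _ f_inj).
by apply/subset_leq_card/fintype.subsetP => B /imsetP[w]; rewrite !inE => wA ->.
Qed.

Lemma card_ord_count n (P : pred nat) : #|[set i : 'I_n | P i]%SET| = count P (iota 0 n).
Proof.
by rewrite -sum1_count -/(index_iota 0 n) -[n in iota 0 n]subn0 -/(index_iota 0 n) big_mkord sum1dep_card.
Qed.

Lemma card_bigcup_le (I T : finType) (F : I -> {set T}) :
  (#|(\bigcup_i F i)%SET| <= \sum_i #|F i|)%N.
Proof.
apply: (big_ind2 (fun (A : {set T}) m => #|A| <= m)%N) => //; first by rewrite cards0.
by move=> A m B m' Am Bm; apply: (leq_trans (leq_card_setU _ _).1); exact: leq_add.
Qed.

Lemma cpx_semiprimes_le n Y M : (Y ^ 2 <= n)%N ->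
  (forall a, count (fun i => few_divisors (primes_in 0 Y) (a + i)) (iota 0 n) <= M)%N ->
  (cpx (indicator semiprimes) n <= (4 * n).+1 + Y`! * 2 ^ M)%N.
Proof.
move=> Yn HM; set y := indicator semiprimes.
pose A (a : nat) := [set i : 'I_n | few_divisors (primes_in 0 Y) (a + i)]%SET.
pose near0 : {set n.-tuple bool} := [set word y n (k%:Z - (2 * n)%:Z) | k : 'I_(4 * n).+1]%SET.
pose far (a : 'I_(Y`!)) : {set n.-tuple bool} :=
  [set w : n.-tuple bool | [set i | tnth w i]%SET \subset A a]%SET.
apply: (@leq_trans #|(near0 :|: \bigcup_a far a)%SET|).
  rewrite /cpx; apply: subset_leq_card; apply/fintype.subsetP => w; rewrite inE => -[x yx wx].
  have [j ->] := closure_block yx wx; rewrite finset.in_setU.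
  (* Windows with |j| <= 2n give at most 4n + 1 words. For the others |j + i| > n >= Y^2, so
     [semiprime_few_divisors] applies at each semiprime position. *)
  have [jn|nj] := leqP `|j|%N (2 * n).
    apply/orP; left; apply/imsetP.
    have kP : (absz (j + (2 * n)%:Z)%R < (4 * n).+1)%N by lia.
    by exists (Ordinal kP) => //=; congr word; lia.
  apply/orP; right; apply/bigcupP.
  have F0 : (Y`!)%:Z != 0 :> int by rewrite eqz_nat -lt0n fact_gt0.
  have aP : (absz (j %% (Y`!)%:Z)%Z < Y`!)%N.
    by have := modz_ge0 j F0; have := ltz_mod j F0; lia.
  exists (Ordinal aP) => //; rewrite inE; apply/fintype.subsetP => i.
  rewrite !inE tnth_mktuple => /asboolP /semiprimesE om.
  have big : (Y ^ 2 < absz (j + i%:Z)%R)%N by have := ltn_ord i; lia.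
  have := semiprime_few_divisors big om; rewrite /few_divisors /=.
  congr (_ <= 1)%N; apply: eq_in_count => p; rewrite mem_primes_in => /and3P[p0 pY pp].
  (* Each p <= Y divides Y!, so reducing j modulo Y! preserves divisibility of j + i by p. *)
  have pF : (p%:Z %| (Y`!)%:Z)%Z by rewrite dvdzE /= dvdn_fact // p0.
  have E : (absz (j %% (Y`!)%:Z)%Z)%:Z + i%:Z = j + i%:Z - (j %/ (Y`!)%:Z)%Z * (Y`!)%:Z.
    by have := divz_eq j (Y`!)%:Z; have := modz_ge0 j F0; lia.
  have : (p%:Z %| (absz (j %% (Y`!)%:Z)%Z)%:Z + i%:Z)%Z = (p%:Z %| j + i%:Z)%Z.
    by rewrite E rpredBr // dvdz_mull.
  by rewrite -PoszD !dvdzE /= => ->.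
apply: leq_trans (leq_card_setU _ _).1 _; apply: leq_add.
  by apply: leq_trans (leq_imset_card _ _) _; rewrite card_ord.
apply: leq_trans (card_bigcup_le _) _.
apply: (@leq_trans (\sum_(a < Y`!) 2 ^ M)); last by rewrite sum_nat_const card_ord.
apply: leq_sum => a _; apply: leq_trans (card_words_supported _) _.
by have := HM a; rewrite leq_exp2l // -card_ord_count.
Qed.

(** * Numerical constants and the asymptotic upper bound *)

(** Follows from e^3 <= 27 <= 32 = 2^5. *)
Lemma ln2_ge (R : realType) : 3 / 5 <= ln 2 :> R.
Proof.
rewrite -ler_expR lnK ?posrE //.
rewrite -(@ler_pXn2r _ 5) ?nnegrE ?expR_ge0 // -expRM_natl.
have -> : 5%:R * (3 / 5) = 3%:R * 1 :> R by field.
rewrite expRM_natl; apply: (@le_trans _ _ (3 ^+ 3)); last lra.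
by rewrite lerXn2r ?nnegrE ?expR_ge0 // expR1_le3.
Qed.

Lemma ln2_le (R : realType) : ln 2 <= 3 / 4 :> R.
Proof.
rewrite -ler_expR lnK ?posrE //.
have -> : 3 / 4 = 8%:R * (3 / 32) :> R by field.
rewrite expRM_natl; apply: (@le_trans _ _ ((1 + 3 / 32) ^+ 8)); first lra.
by rewrite lerXn2r ?nnegrE ?expR_ge0 ?expR_ge1Dx //; lra.
Qed.

Lemma expR_ge_cube (R : realType) (x : R) : 0 <= x -> x ^+ 3 / 6 <= expR x.
Proof.
move=> x0; apply: le_trans (expR_ge1Dxn 2 x0).
by rewrite lerDr ler01.
Qed.

Lemma few_divisors_count_asymp (R : realType) (n Y : nat) (c L x : R) :
  3 ^+ 8 <= c -> 3 * c <= L -> 200 <= L -> x = expR L -> n%:R = expR x ->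
  Y = Num.truncn (expR (x / (7 * L + 3))) ->
  forall a, (count (fun i => few_divisors (primes_in 0 Y) (a + i)) (iota 0 n))%:R <=
    29 * n%:R * L ^+ 2 / x.
Proof.
move=> c8 cL L0 xE nE YE a.
have c0 : 0 <= c by apply: le_trans c8; apply: exprn_ge0.
set D := 7 * L + 3; set y := expR (x / D); rewrite -/D -/y in YE.
have D0 : 0 < D by rewrite /D; lra.
have x3 : L ^+ 3 / 6 <= x by rewrite xE; apply: expR_ge_cube; lra.
have L2 : 200 * L <= L ^+ 2 by rewrite expr2 ler_wpM2r //; lra.
have L3 : 200 * L ^+ 2 <= L ^+ 3 by rewrite exprS ler_wpM2r ?sqr_ge0.
have xL : L <= x / D by rewrite ler_pdivlMr // /D mulrDr (mulrCA L) -expr2; lra.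
have x0 : 0 < x by rewrite xE expR_gt0.
have y0 : 0 < y by exact: expR_gt0.
have yx : x <= y by rewrite xE /y ler_expR.
have y1 : 1 <= y by rewrite /y -expR0 ler_expR; lra.
have /andP[Yy yY] : Y%:R <= y < Y.+1%:R by rewrite YE truncn_itv // ltW.
have Y0 : (0 < Y)%N by rewrite YE truncn_gt0.
set s := primes_in 0 Y.
have us : uniq s := primes_in_uniq 0 Y.
have prs : {in s, forall p, prime p} := @primes_in_prime 0 Y.
(* A depth r > 7L beats 3 [recip_sum] <= 6L + 15/2 by L up to a constant, so the tail is at most e^8
   / x, and c bounds e^8. *)
set r := (Num.truncn (7 * L)).+1.
have /andP[r1 r2] : r.-1%:R <= 7 * L < r%:R by rewrite /r /= truncn_itv //; lra.
have rS : r%:R = r.-1%:R + 1 :> R by rewrite natr1.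
have lny : ln y = x / D by rewrite /y expRK.
have n0 : 0 <= n%:R :> R by [].
have V1 : euler_prod R s <= D / x.
  have lnY : x / D <= ln Y.+1%:R by rewrite -lny ler_ln ?posrE ?ltr0n // ltW.
  have h := euler_prod_ln R Y; rewrite -/s in h.
  have /andP[/ltW V0 _] := euler_prod_bounds R prs.
  have := le_trans (ler_wpM2l V0 lnY) h.
  by rewrite mulrA ler_pdivrMr // mul1r ler_pdivlMr.
have S1 : recip_sum R s <= 5 / 2 + 2 * L.
  set K := (trunc_log 2 Y).+1.
  have YK : (Y <= 2 ^ K)%N by rewrite ltnW // trunc_log_ltn.
  have sK : recip_sum R s <= recip_sum R (primes_in 0 (2 ^ K)).
    by rewrite (@primes_in_cat 0 Y) // recip_sum_cat lerDl recip_sum_ge0.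
  apply: le_trans sK _; apply: le_trans (recip_sum_primes_le R (ltn0Sn _)) _.
  rewrite lerD2l ler_wpM2l // -[L]expRK -xE ler_ln ?posrE ?ltr0n //.
  have hK : (2 ^ K.-1)%:R <= y by apply: le_trans Yy; rewrite ler_nat trunc_logP.
  have hl : K.-1%:R * ln 2 <= x / D.
    by rewrite -lny mulr_natl -lnXn // ler_ln ?posrE ?exprn_gt0 // -natrX.
  have KS : K%:R = K.-1%:R + 1 :> R by rewrite natr1.
  move: hl; rewrite -/K KS ler_pdivlMr //; have := ln2_ge R; have := ler0n R K.-1; rewrite /D.
  move: (K.-1%:R) (ln 2) => k l k0 l0; rewrite -mulrA => h'.
  have lD : 2 <= l * (7 * L + 3) by nra.
  have := ler_wpM2l k0 lD => h.
  have : 2 * L <= L ^+ 3 / 6 by lra.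
  by lra.
have E1 : expR (3 * recip_sum R s - r%:R) <= c / x.
  apply: (@le_trans _ _ (expR (8%:R * 1 - L))); first by rewrite ler_expR; lra.
  rewrite expRB -xE ler_wpM2r ?invr_ge0 ?(ltW x0) // expRM_natl.
  apply: le_trans c8; by rewrite lerXn2r ?nnegrE ?expR_ge0 // expR1_le3.
(* Here D = 7L + 3 is used: r + 2 <= D gives y^(r+2) <= y^D = n, and one factor y >= x is spared. *)
have Q1 : (size s).+1%:R ^+ r.+1 <= n%:R / x.
  apply: (@le_trans _ _ (y ^+ r.+1)).
    rewrite lerXn2r ?nnegrE // ?(ltW y0) //.
    by apply: le_trans Yy; rewrite ler_nat size_primes_le.
  apply: (@le_trans _ _ (n%:R / y)); last by rewrite ler_wpM2l // lef_pV2 // posrE.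
  rewrite nE -expRM_natl -expRB ler_expR lerBrDr -[X in _ + X]mul1r -mulrDl natr1.
  rewrite mulrA ler_pdivrMr // mulrC ler_wpM2l ?(ltW x0) //.
  have -> : r.+2%:R = r%:R + 2 :> R by rewrite -natrD addn2.
  rewrite /D; lra.
apply: le_trans (few_divisors_bound R n a r us prs) _; rewrite -/s.
have S0 := recip_sum_ge0 R s.
set S := recip_sum R s in S0 S1 E1 *; set V := euler_prod R s in V1 *.
have /andP[/ltW V0 _] := euler_prod_bounds R prs; rewrite -/V in V0.
have B1 : n%:R * V * (1 + 2 * S) <= n%:R * (D / x) * (6 + 4 * L).
  apply: ler_pM; rewrite ?mulr_ge0 ?ler_wpM2l //; lra.
have B2 : n%:R * (1 + S) * expR (3 * S - r%:R) <= n%:R * (4 + 2 * L) * (c / x).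
  apply: ler_pM => //; rewrite ?mulr_ge0 ?expR_ge0 ?ler_wpM2l //; lra.
apply: le_trans (lerD (lerD B1 Q1) B2) _.
have -> : n%:R * (D / x) * (6 + 4 * L) + n%:R / x + n%:R * (4 + 2 * L) * (c / x) =
  n%:R / x * (D * (6 + 4 * L) + 1 + (4 + 2 * L) * c).
  by field; rewrite gt_eqF.
have -> : 29 * n%:R * L ^+ 2 / x = n%:R / x * (29 * L ^+ 2) by field; rewrite gt_eqF.
rewrite ler_wpM2l ?divr_ge0 ?(ltW x0) // /D.
have cL1 : 3 * c * L <= L ^+ 2 by rewrite expr2 ler_wpM2r //; lra.
(* The leading coefficient is 7 times 4 = 28; the remaining terms fit in one more L^2 because 3c <=
   L and L >= 200. *)
have -> : (7 * L + 3) * (6 + 4 * L) + 1 + (4 + 2 * L) * c =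
  28 * L ^+ 2 + 54 * L + 19 + 4 * c + 2 * (c * L) by ring.
rewrite -mulrA in cL1; move: (L ^+ 2) (c * L) L2 cL1 => q t L2 cL1.
clear -L0 cL L2 cL1 c0; lra.
Qed.

Lemma fact_le_expn m : (m`! <= m ^ m)%N.
Proof.
rewrite fact_prod -[X in (_ <= _ ^ X)%N](subn1 m.+1) -prod_nat_const_nat.
by rewrite big_nat [leqRHS]big_nat; apply: leq_prod => i /andP[].
Qed.

Lemma cpx_upper (R : realType) (n : nat) (c L x : R) :
  3 ^+ 8 <= c -> 3 * c <= L -> 200 <= L -> x = expR L -> n%:R = expR x ->
  (cpx (indicator semiprimes) n)%:R <= expR (23 * n%:R * L ^+ 2 / x).
Proof.
move=> c8 cL L0 xE nE.
have HM0 := few_divisors_count_asymp c8 cL L0 xE nE; clear c c8 cL.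
set D := 7 * L + 3; set y := expR (x / D).
set Y := Num.truncn y; set B := 29 * n%:R * L ^+ 2 / x; set M := Num.truncn B.
have D0 : 4 <= D by rewrite /D; lra.
have x3 : L ^+ 3 / 6 <= x by rewrite xE; apply: expR_ge_cube; lra.
have L2 : 200 * L <= L ^+ 2 by rewrite expr2 ler_wpM2r //; lra.
have L3 : 200 * L ^+ 2 <= L ^+ 3 by rewrite exprS ler_wpM2r ?sqr_ge0.
have xL : 400 <= x by lra.
have x0 : 0 < x by lra.
have y0 : 0 < y by exact: expR_gt0.
have n0 : 0 <= n%:R :> R by [].
have B0 : 0 <= B.
  by apply: divr_ge0; [apply: mulr_ge0; [apply: mulr_ge0|exact: sqr_ge0]|exact: ltW].
have xD : 0 <= x / D by apply: divr_ge0; lra.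
have xD2 : x / D <= x / 4 by apply: ler_wpM2l; [|rewrite lef_pV2 ?posrE]; lra.
have y1 : 1 <= y by rewrite /y -expR0 ler_expR.
have /andP[Yy _] : Y%:R <= y < Y.+1%:R by rewrite truncn_itv // ltW.
have Y0 : (0 < Y)%N by rewrite truncn_gt0.
have ye : y <= expR (x / 4) by rewrite ler_expR.
have Yn : (Y ^ 2 <= n)%N.
  rewrite -(ler_nat R) natrX nE; apply: (@le_trans _ _ (expR (x / 4) ^+ 2)).
    by rewrite lerXn2r ?nnegrE ?expR_ge0 // (le_trans Yy).
  by rewrite -expRM_natl ler_expR; lra.
have HM a : (count (fun i => few_divisors (primes_in 0 Y) (a + i)) (iota 0 n) <= M)%N.
  by rewrite truncn_ge_nat //; exact: HM0.
have := cpx_semiprimes_le Yn HM; rewrite -(ler_nat R) => /le_trans; apply.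
have F1 : (Y`!)%:R <= expR (expR (x / 4) * x).
  apply: (@le_trans _ _ ((Y ^ Y)%:R)); first by rewrite ler_nat fact_le_expn.
  rewrite natrX -[Y%:R in X in X <= _]lnK ?posrE ?ltr0n // -expRM_natl ler_expR.
  apply: ler_pM; rewrite ?ln_ge0 ?ler1n //; first exact: le_trans Yy ye.
  apply: (@le_trans _ _ (ln y)); first by rewrite ler_ln ?posrE ?ltr0n.
  by rewrite /y expRK; lra.
have F2 : (2 ^ M)%:R <= expR (3 / 4 * B).
  rewrite natrX -[2%:R]lnK ?posrE // -expRM_natl ler_expR mulrC.
  by apply: ler_pM; rewrite ?ln_ge0 ?ln2_le ?ler1n // truncn_le.
have F3 : (4 * n).+1%:R <= expR (4 + x) :> R.
  rewrite expRD -nE -natr1 natrM.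
  have e4 : 5 <= expR 4 :> R by have := expR_ge1Dx (4 : R); lra.
  have n1 : 1 <= n%:R :> R by rewrite nE -expR0 ler_expR ltW.
  by nra.
rewrite natrD natrM; set f := (Y`!)%:R in F1 *; set g := (2 ^ M)%:R in F2 *.
set h := (4 * n).+1%:R in F3 *.
have f1 : 1 <= f by rewrite ler1n fact_gt0.
have g1 : 1 <= g by rewrite ler1n expn_gt0.
have h1 : 1 <= h by rewrite ler1n.
have fg1 : 1 <= f * g by nra.
(* All factors are at least 1, so the sum is at most twice the product, and exponents can then be
   added. *)
apply: (@le_trans _ _ (2 * (h * (f * g)))); first nra.
have e1 : 2 <= expR 1 :> R by have := expR_ge1Dx (1 : R); lra.
apply: (@le_trans _ _ (expR 1 * (expR (4 + x) * (expR (expR (x / 4) * x) * expR (3 / 4 * B))))).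
  apply: ler_pM; [by []|by rewrite !mulr_ge0 ?ler0n|exact: e1|].
  apply: ler_pM; [exact: ler0n|by rewrite mulr_ge0 ?ler0n|exact: F3|].
  by apply: ler_pM; rewrite ?ler0n.
rewrite -!expRD ler_expR.
(* With ln 2 <= 3/4 the main exponent is 29 times 3/4, that is 87/4; the remaining 5/4 must cover
   Y!, the words near 0 and the constant. *)
have -> : 23 * n%:R * L ^+ 2 / x = 3 / 4 * B + 5 / 4 * (n%:R * L ^+ 2 / x).
  by rewrite /B; field; rewrite gt_eqF.
(* z is the fourth root of n; since x^2 <= z, the remaining exponent, of order x z, is small against
   n / x. *)
set z := expR (x / 4).
have nz : n%:R = z * z * (z * z).
  by rewrite nE /z -!expRD; congr expR; field.
have zx : (x / 4) ^+ 3 / 6 <= z by apply: expR_ge_cube; lra.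
have z1 : 1 <= z by rewrite /z -[leLHS]expR0 ler_expR; lra.
have zx2 : x ^+ 2 <= z.
  apply: le_trans zx; have h3 : 400 * x ^+ 2 <= x ^+ 3 by rewrite exprS ler_wpM2r ?sqr_ge0.
  have -> : (x / 4) ^+ 3 / 6 = x ^+ 3 / 384 by field.
  by have := sqr_ge0 x; lra.
have xz : x <= x * z by rewrite ler_peMr // ltW.
suff : 4 * (x * z) <= n%:R * L ^+ 2 / x.
  rewrite -/z (mulrC z x); move: (x * z) (3 / 4 * B) (n%:R * L ^+ 2 / x) xz => t u w xz h'.
  clear -xz h' xL; lra.
rewrite ler_pdivlMr // nz.
have zz : 0 <= z * z by rewrite mulr_ge0 // ltW // (lt_le_trans ltr01).
have LL : 4 <= L ^+ 2 by clear -L0 L2; lra.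
have z0 : 0 <= z by apply: le_trans z1.
have -> : 4 * (x * z) * x = x ^+ 2 * z * 4 by ring.
have zz1 : 1 <= z * z by rewrite -[leLHS]mulr1; apply: ler_pM.
apply: ler_pM => //; first by rewrite mulr_ge0 ?sqr_ge0.
apply: (@le_trans _ _ (z * z)); first by apply: ler_pM; rewrite ?sqr_ge0.
by rewrite ler_peMr.
Qed.

(** Writing n = exp x and x = exp L reduces both asymptotic claims to inequalities valid once L
    exceeds a constant. *)
Lemma near_lnln (R : realType) (c : R) : \forall n \near \oo, exists L x : R,
  [/\ c <= L, x = expR L, n%:R = expR x, ln n%:R = x & ln x = L].
Proof.
near=> n; exists (ln (ln n%:R)), (ln n%:R).
have h : expR (expR c) <= n%:R by near: n; exact: nbhs_infty_ger.
have n0 : 0 < n%:R :> R by apply: lt_le_trans h; exact: expR_gt0.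
have h1 : expR c <= ln n%:R by rewrite -[leLHS]expRK ler_ln ?posrE ?expR_gt0.
have x0 : 0 < ln n%:R :> R by apply: lt_le_trans h1; exact: expR_gt0.
by split; rewrite ?lnK ?posrE // -[leLHS]expRK ler_ln ?posrE ?expR_gt0.
Unshelve. all: by end_near. Qed.

Lemma semiprime_cpx_upper (R : realType) :
  ll_oexp (fun n : nat => (cpx (indicator semiprimes) n)%:R : R) 4
    (fun n : nat => 23 * n%:R * (ln (ln n%:R)) ^+ 2 / (ln 4 * ln n%:R)).
Proof.
(* The factor ln 4 in the exponent turns the base 4 into e, so constant 1 and zero error sequence
   suffice. *)
exists 1; first exact: ltr01.
exists (fun=> 0); first exact: cvg_cst.
near=> n.
have [L [x [L0 xE nE -> ->]]] : exists L x : R,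
  [/\ 3 * 3 ^+ 8 + 200 <= L, x = expR L, n%:R = expR x, ln n%:R = x & ln x = L].
  by near: n; exact: near_lnln.
rewrite mul1r addr0 -[X in X `^ _]lnK ?posrE // -expRM.
have l4 : 0 < ln 4 :> R by rewrite ln_gt0 // ltr1n.
have x0 : 0 < x by rewrite xE expR_gt0.
have -> : ln 4 * (23 * n%:R * L ^+ 2 / (ln 4 * x)) = 23 * n%:R * L ^+ 2 / x.
  by field; rewrite !gt_eqF.
have c0 : 0 <= 3 * 3 ^+ 8 :> R by rewrite mulr_ge0 // exprn_ge0.
by apply: (cpx_upper (lexx _)) => //; apply: le_trans L0; rewrite ?lerDl ?lerDr.
Unshelve. all: by end_near. Qed.

(** * Realizing prescribed patterns with Dickson's conjecture *)

(** Each i in D receives a fresh prime l > n + M, and the Chinese remainder theorem adds the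
    congruence m = -i modulo l^3. The last clause describes all primes dividing M, as needed for the
    local condition in Dickson's conjecture. *)
Lemma cube_moduli n Q (D : seq nat) : (0 < Q)%N -> all (fun i => i < n)%N D ->
  exists M m : nat, [/\ (0 < M)%N, (Q %| M)%N, (Q %| m)%N,
    {in D, forall i, exists l, [/\ prime l, l ^ 3 %| M & l ^ 3 %| m + i]%N} &
    forall p, prime p -> (p %| M)%N ->
      (p %| Q)%N \/ (n <= p)%N /\ exists2 i, i \in D & (p %| m + i)%N].
Proof.
move=> Q0; elim: D => [_|i D IHD /= /andP[ni nD]].
  by exists Q, Q; split=> // p _; left.
have [M [m [M0 QM Qm HD Hp]]] := IHD nD.
have [l lM pl] := prime_above (n + M).
have l3 : coprime M (l ^ 3).
  rewrite coprime_sym coprimeXl // prime_coprime //; apply/negP => /(dvdn_leq M0); lia.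
have i3 : (i <= l ^ 3)%N.
  by apply: (@leq_trans l); [lia|rewrite -[leqLHS]expn1 leq_pexp2l // prime_gt0].
set m' := chinese M (l ^ 3) m (l ^ 3 - i).
have mM d j : (d %| M)%N -> (d %| m' + j)%N = (d %| m + j)%N.
  move=> dM; have E : m' = m %[mod M] by exact: chinese_modl.
  rewrite /dvdn -modnDml -[in RHS]modnDml; congr ((_ + _) %% _ == _)%N.
  by rewrite -(modn_dvdm m' dM) E modn_dvdm.
have ml : (l ^ 3 %| m' + i)%N.
  have E : m' = l ^ 3 - i %[mod l ^ 3] by exact: chinese_modr.
  by rewrite /dvdn -modnDml E modnDml subnK // modnn.
exists (M * l ^ 3)%N, m'; split.
- by rewrite muln_gt0 M0 expn_gt0 prime_gt0.
- exact: dvdn_mulr.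
- by have := mM Q 0%N QM; rewrite !addn0 => ->.
- move=> j; rewrite inE => /orP[/eqP ->|/HD[l' [pl' l'M l'm]]].
    by exists l; split => //; exact: dvdn_mull.
  by exists l'; split=> //; [exact: dvdn_mulr|rewrite mM].
- move=> p pp; rewrite Euclid_dvdM // => /orP[pM|].
    have [pQ|[np [j jD pj]]] := Hp p pp pM; [by left|right; split=> //].
    by exists j; [rewrite inE jD orbT|rewrite mM].
  rewrite Euclid_dvdX // andbT dvdn_prime2 // => /eqP ->; right; split; first lia.
  by exists i; [rewrite mem_head|apply: dvdn_trans ml; rewrite dvdn_exp].
Qed.

Lemma prime_dvd_prodz (I : finType) (F : I -> int) (p : nat) : prime p ->
  (p%:Z %| \prod_i F i)%Z -> exists i, (p%:Z %| F i)%Z.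
Proof.
move=> pp; apply: contraPP => /forallNP H; apply/negP.
apply: (big_ind (fun x => ~~ (p%:Z %| x)%Z)) => [|x y|i _].
- by rewrite dvdzE /= dvdn1; apply/negP => /eqP p1; rewrite p1 in pp.
- by rewrite !dvdzE abszM /= Euclid_dvdM // negb_or => -> ->.
- exact/negP/H.
Qed.

Lemma dvdn_add_inj n p m i j : (n <= p)%N -> (i < n)%N -> (j < n)%N ->
  (p %| m + i)%N -> (p %| m + j)%N -> i = j.
Proof.
move=> np ni nj /eqP pi /eqP pj; apply/eqP.
rewrite -(modn_small (leq_trans ni np)) -(modn_small (leq_trans nj np)).
by rewrite -(eqn_modDl m) pi pj.
Qed.

(* Says that i is p q with p and q prime and p <= z < q. *)
Definition split_semiprime (z i : nat) : bool :=
  [&& (pdiv i <= z)%N, prime (i %/ pdiv i) & (z < i %/ pdiv i)%N].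

Lemma dickson_pattern n z (T U : {set 'I_n}) : Dickson_conjecture ->
  U \subset T -> {in T, forall i : 'I_n, split_semiprime z i} ->
  (forall q, prime q -> (z < q)%N -> exists c, {in T, forall i : 'I_n, i <> c %[mod q]}) ->
  exists s : nat, {in T, forall i : 'I_n, (bigomega (s + i) == 2)%N = (i \in U)}.
Proof.
move=> dickson UT HT adm.
pose D := [seq val i | i <- enum (T :\: U)%SET].
have nD : all (fun i => i < n)%N D by apply/allP => _ /mapP[i _ ->]; exact: ltn_ord.
(* The square ensures that (pdiv u) p divides m for every prime p <= z, including p = pdiv u. *)
have Q0 : (0 < z`! ^ 2)%N by rewrite expn_gt0 fact_gt0.
have [M [m [M0 QM Qm HD Hp]]] := cube_moduli Q0 nD.
have HU (u : 'I_n) : u \in U -> [/\ prime (pdiv u), (pdiv u <= z)%N,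
    prime (u %/ pdiv u), (z < u %/ pdiv u)%N & (pdiv u * (u %/ pdiv u) = u)%N].
  move=> uU; have /and3P[pz pq zq] := HT u (fintype.subsetP UT u uU).
  split=> //; last by rewrite mulnC divnK // pdiv_dvd.
  rewrite pdiv_prime //; case: (val u) pq zq => [|[|//]] /=; last by rewrite divn1.
  by rewrite div0n.
have fz p : prime p -> (p <= z)%N -> (p %| z`!)%N by move=> pp pz; rewrite dvdn_fact // prime_gt0.
have pM u : u \in U -> (pdiv u %| M)%N.
  case/HU => pp pz _ _ _; apply: dvdn_trans QM; rewrite -mulnn; exact/dvdn_mulr/fz.
have pm u : u \in U -> (pdiv u %| m + u)%N.
  move=> uU; have [pp pz _ _ _] := HU u uU.
  apply: dvdn_add (pdiv_dvd u); apply: dvdn_trans Qm; rewrite -mulnn; exact/dvdn_mulr/fz.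
(* The linear forms are (m + u + M y) / pdiv u for u in U. *)
pose a (i : 'I_#|U|) : int := ((m + enum_val i) %/ pdiv (enum_val i))%N%:Z.
pose b (i : 'I_#|U|) : int := (M %/ pdiv (enum_val i))%N%:Z.
have abE (i : 'I_#|U|) (y : int) : (pdiv (enum_val i))%:Z * (a i + b i * y) = (m + enum_val i)%N%:Z + M%:Z * y.
  rewrite mulrDr mulrA -!PoszM mulnC divnK ?pm ?enum_valP //.
  by rewrite mulnC divnK ?pM ?enum_valP.
have b1 (i : 'I_#|U|) : 1 <= b i.
  rewrite lez_nat divn_gt0 ?pdiv_gt0 //; exact: dvdn_leq (pM _ (enum_valP i)).
have loc p : prime p -> exists y : int, ~ (p%:Z %| \prod_(i < #|U|) (a i + b i * y))%Z.
  move=> pp; have [pdM|pnM] := boolP (p %| M)%N.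
    (* For p dividing M, y = 0 works. If p <= z, then p would divide the prime u / pdiv u > z;
       otherwise p >= n divides m + j for some j outside U and also m + u, forcing j = u. *)
    exists 0 => /(prime_dvd_prodz pp)[i]; rewrite mulr0 addr0.
    set u := enum_val i; have uU : u \in U := enum_valP i.
    have [ru rz pq zq uE] := HU u uU.
    rewrite dvdzE /= -/u => pa.
    have pum : (pdiv u * p %| m + u)%N.
      by rewrite mulnC -dvdn_divRL // pm.
    have [pQ|[np [j jD pj]]] := Hp p pp pdM.
      have pz : (p <= z)%N.
        by apply: prime_dvd_fact_le => //; move: pQ; rewrite Euclid_dvdX // => /andP[].
      have : (pdiv u * p %| m)%N. by apply: dvdn_trans Qm; rewrite -mulnn; apply: dvdn_mul; exact: fz.
      move=> pm'; move: pum; rewrite dvdn_addr // -{2}uE dvdn_pmul2l ?pdiv_gt0 //.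
      by rewrite dvdn_prime2 // => /eqP E; move: zq; rewrite -E ltnNge pz.
    move: jD => /mapP[j']; rewrite mem_enum finset.in_setD => /andP[j'U _] jE.
    have pu : (p %| m + u)%N by apply: dvdn_trans pum; exact: dvdn_mull.
    have jn : (j < n)%N by rewrite jE; exact: ltn_ord.
    have ju : j = u :> nat := dvdn_add_inj np jn (ltn_ord u) pj pu.
    by move/negP: j'U; apply; rewrite (_ : j' = u) //; apply: val_inj; rewrite -jE.
  have zp : (z < p)%N.
    rewrite ltnNge; apply: contra pnM => pz; apply: dvdn_trans QM; rewrite -mulnn.
    exact/dvdn_mulr/fz.
  have [c Hc] := adm p pp zp.
  have cMp : coprime M p by rewrite coprime_sym prime_coprime.
  (* With c a class that T misses modulo p, y is chosen so that m + M y = X is -c modulo p; then p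
     divides no X + u. *)
  set X := chinese M p m (p - c %% p)%N.
  have /eqP XM : X == m %[mod M] by rewrite chinese_modl.
  have XP : (p %| X + c)%N.
    rewrite /dvdn -modnDml chinese_modr // modnDml -modnDmr.
    by rewrite subnK ?modnn // ltnW // ltn_mod prime_gt0.
  exists ((X%:Z - m%:Z) %/ M%:Z)%Z => /(prime_dvd_prodz pp)[i pi].
  set u := enum_val i; have uU : u \in U := enum_valP i.
  have : (p%:Z %| (X + u)%N%:Z)%Z.
    have -> : (X + u)%N%:Z = (m + u)%N%:Z + M%:Z * ((X%:Z - m%:Z) %/ M%:Z)%Z.
      rewrite mulrC divzK; first by rewrite !PoszD; ring.
      by rewrite -eqz_mod_dvd !modz_nat XM.
    by rewrite -abE dvdz_mull.
  rewrite dvdzE /= => pXu; apply: (Hc u (fintype.subsetP UT u uU)).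
  apply/eqP; rewrite -(eqn_modDl X); move: pXu XP; rewrite /dvdn => /eqP -> /eqP ->.
  by [].
have [s0 Hs] : exists s0 : nat, forall i : 'I_#|U|,
    exists2 q : nat, prime q & a i + b i * s0%:Z = q%:Z.
  (* If no s0 existed, the set that Dickson's conjecture declares infinite would be empty. *)
  apply: contrapT => /forallNP H; apply: (dickson #|U| a b b1 loc).
  rewrite (_ : [set _ | _]%classic = set0); first exact: finite_set0.
  by apply/seteqP; split => // x /H.
exists (m + M * s0)%N => i iT; have [iU|iU] := boolP (i \in U).
  have [pr _ _ _ _] := HU i iU.
  have [q pq] := Hs (enum_rank_in iU i); move/(congr1 (fun t => (pdiv i)%:Z * t)).
  have -> : (pdiv i)%:Z = (pdiv (enum_val (enum_rank_in iU i)))%:Z by rewrite enum_rankK_in.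
  rewrite abE enum_rankK_in // -!PoszM -PoszD => -[E].
  by rewrite addnAC E bigomegaM ?prime_gt0 // !bigomega_prime.
have iD : val i \in D by apply: map_f; rewrite mem_enum finset.in_setD iU.
have [l [pl lM lm]] := HD _ iD.
have : (l ^ 3 %| m + M * s0 + i)%N by rewrite addnAC dvdn_add // dvdn_mulr.
have l0 := prime_gt0 pl.
have l3 : bigomega (l ^ 3) = 3%N.
  have -> : (l ^ 3 = l * (l * l))%N by rewrite !expnS muln1.
  by rewrite !bigomegaM ?muln_gt0 ?l0 // (bigomega_prime pl).
(* The zero multiple is the number 0, with [bigomega] 0; any other multiple of l^3 has at least
   three prime factors. *)
case/dvdnP => -[|k] ->; first by rewrite mul0n /bigomega big_nil.
by rewrite bigomegaM ?expn_gt0 ?l0 // l3 addnC.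
Qed.

(** * Shattered sets of positions and avoidance of residue classes *)

(** Sending a word to its support within T maps the occurring words onto the powerset of T. *)
Lemma cpx_ge_shattered (y : full_shift) n (T : {set 'I_n}) :
  (forall U : {set 'I_n}, U \subset T ->
    exists j : int, {in T, forall i : 'I_n, y (j + i%:Z) = (i \in U)}) ->
  (2 ^ #|T| <= cpx y n)%N.
Proof.
move=> H; rewrite -card_powerset /cpx.
pose f (w : n.-tuple bool) : {set 'I_n} := [set i in T | tnth w i]%SET.
set W := [pred w | _].
apply: leq_trans (leq_imset_card f W).
apply/subset_leq_card/fintype.subsetP => U; rewrite powersetE => UT.
have [j Hj] := H U UT; apply/imsetP; exists (word y n j).
  rewrite inE; exists y; last by exists j => i; rewrite tnth_mktuple.
  apply: subset_closure; exists 0 => //; apply/funext => i.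
  by rewrite /shift_pow addr0.
apply/setP => i; rewrite finset.in_set; have [iT|iT] := boolP (i \in T) => /=.
  by rewrite tnth_mktuple Hj.
by apply/negbTE; apply: contra iT; exact: (fintype.subsetP UT).
Qed.

Lemma semiprime_cpx_ge n z (T : {set 'I_n}) : Dickson_conjecture ->
  {in T, forall i : 'I_n, split_semiprime z i} ->
  (forall q, prime q -> (z < q)%N -> exists c, {in T, forall i : 'I_n, i <> c %[mod q]}) ->
  (2 ^ #|T| <= cpx (indicator semiprimes) n)%N.
Proof.
move=> dickson HT adm; apply: cpx_ge_shattered => U UT.
have [s Hs] := dickson_pattern dickson UT HT adm; exists s%:Z => i iT.
rewrite -(Hs i iT) -PoszD; apply/asboolP/eqP => //.
Qed.

(** Pigeonhole: the q residue classes partition T, so some class has at most |T| / q elements. *)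
Lemma sparse_class (n q : nat) (T : {set 'I_n}) : (0 < q)%N ->
  exists c, (q * #|[set i in T | (i == c %[mod q])%N]%SET| <= #|T|)%N.
Proof.
case: q => // q _; apply: contrapT => /forallNP H.
pose A (c : nat) := [set i in T | (i == c %[mod q.+1])%N]%SET.
have E : (\sum_(c < q.+1) #|A c| = #|T|)%N.
  rewrite -sum1_card (partition_big (fun i : 'I_n => inord (i %% q.+1) : 'I_q.+1) predT) //=.
  apply: eq_bigr => c _; rewrite -sum1_card; apply: eq_bigl => i.
  by rewrite finset.in_set -val_eqE /= inordK ?ltn_pmod // (modn_small (ltn_ord c)).
have : (\sum_(c < q.+1) #|T|.+1 <= \sum_(c < q.+1) q.+1 * #|A c|)%N.
  by apply: leq_sum => c _; rewrite ltnNge; apply/negP; exact: H.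
by rewrite -big_distrr /= E sum_nat_const card_ord leq_mul2l ltnn.
Qed.

(** The sparse class for each q is chosen in the original [T0], not in the current T, so each q
    costs at most |T0| / q and the losses add up. *)
Lemma avoid_classes (R : realType) n (s : seq nat) (T0 : {set 'I_n}) :
  {in s, forall q, prime q} ->
  exists T : {set 'I_n}, [/\ T \subset T0,
    {in s, forall q, exists c, {in T, forall i : 'I_n, i <> c %[mod q]}} &
    #|T0|%:R * (1 - recip_sum R s) <= #|T|%:R].
Proof.
elim: s => [|q s IHs] prs.
  by exists T0; split=> //; rewrite /recip_sum big_nil subr0 mulr1.
have [|T [TT0 HT cT]] := IHs; first by move=> p ps; apply: prs; rewrite inE ps orbT.
have q0 : (0 < q)%N by apply/prime_gt0/prs/mem_head.
have [c Hc] := sparse_class T0 q0.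
set B := [set i in T0 | (i == c %[mod q])%N]%SET in Hc.
exists (T :\: B)%SET; split.
- exact: fintype.subset_trans (finset.subsetDl _ _) TT0.
- move=> p; rewrite inE => /orP[/eqP ->|ps].
    exists c => i; rewrite finset.in_setD => /andP[/negP iB iT] /eqP E; apply: iB.
    by rewrite finset.in_set E andbT (fintype.subsetP TT0).
  have [c' Hc'] := HT p ps; exists c' => i; rewrite finset.in_setD => /andP[_]; exact: Hc'.
have q0' : 0 < q%:R :> R by rewrite ltr0n.
have hB : #|B|%:R <= #|T0|%:R * q%:R^-1 :> R.
  by rewrite ler_pdivlMr // mulrC -natrM ler_nat.
have hT : #|T|%:R <= #|(T :\: B)%SET|%:R + #|B|%:R :> R.
  rewrite -natrD ler_nat -(cardsID B T) addnC leq_add2l.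
  exact/subset_leq_card/subsetIr.
rewrite recip_sum_cons; lra.
Qed.

(** * Counting semiprimes with one small and one large prime factor *)

Definition semiprime_list (n z w : nat) : seq nat :=
  [seq (p * q)%N | p <- primes_in 0 w, q <- primes_in z (n.-1 %/ p)].

Lemma semiprime_list_uniq n z w : (w <= z)%N -> uniq (semiprime_list n z w).
Proof.
move=> wz; apply: allpairs_uniq_dep => [|p _|]; [exact: primes_in_uniq|exact: primes_in_uniq|].
move=> _ _ /allpairsPdep[p [q [pw qz ->]]] /allpairsPdep[p' [q' [p'w q'z ->]]] /= E.
move: pw qz p'w q'z; rewrite !mem_primes_in => /and3P[p0 pw pp] /and3P[zq _ qp].
move=> /and3P[p'0 p'w p'p] /and3P[zq' _ q'p].
have : (p %| p' * q')%N by rewrite -E dvdn_mulr.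
(* The case p = q' is excluded by p <= w <= z < q'. *)
rewrite Euclid_dvdM // !dvdn_prime2 // => /orP[/eqP pE|/eqP pE]; last by lia.
by rewrite -pE in E *; move/eqP: E; rewrite eqn_pmul2l // => /eqP ->.
Qed.

Lemma pdiv_semiprime p q : prime p -> prime q -> (p < q)%N -> pdiv (p * q) = p.
Proof.
move=> pp qp pq; have h : (1 < p * q)%N by have := prime_gt1 pp; have := prime_gt1 qp; nia.
have := pdiv_dvd (p * q); rewrite Euclid_dvdM ?pdiv_prime // !dvdn_prime2 ?pdiv_prime //.
case/orP => /eqP // E; have := pdiv_min_dvd (prime_gt1 pp) (dvdn_mulr q (dvdnn p)).
by rewrite E leqNgt pq.
Qed.

Lemma mem_semiprime_list n z w i : (0 < n)%N -> (w <= z)%N -> i \in semiprime_list n z w ->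
  (i < n)%N /\ split_semiprime z i.
Proof.
move=> n0 wz /allpairsPdep[p [q [pw qz ->]]].
move: pw qz; rewrite !mem_primes_in => /and3P[p0 pw pp] /and3P[zq qn qp].
have := leq_divM n.-1 p; have : (q * p <= n.-1 %/ p * p)%N by rewrite leq_mul2r qn orbT.
move=> h1 h2; split; first by rewrite mulnC; move: (leq_trans h1 h2); lia.
rewrite /split_semiprime pdiv_semiprime // ?mulKn // ?(leq_trans pw) //; last by lia.
by rewrite qp.
Qed.

Lemma size_semiprime_list n z w :
  size (semiprime_list n z w) = (\sum_(p <- primes_in 0 w) size (primes_in z (n.-1 %/ p)))%N.
Proof.
by rewrite size_allpairs_dep sumnE big_map.
Qed.

Lemma size_primes_real (R : realType) n x : (0 < n)%N -> (x <= n)%N ->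
  (x%:R - 1) * ln 2 <= ((size (primes_in 0 x))%:R + 1) * ln n%:R :> R.
Proof.
move=> n0 xn; have n1 : 1 <= n%:R :> R by rewrite ler1n.
have ln2 : 0 <= ln 2 :> R by rewrite ln_ge0 // ler1n.
case: (leqP 2 x) => x2; last first.
  apply: (@le_trans _ _ 0); last by rewrite mulr_ge0 ?ln_ge0 // addr_ge0.
  by rewrite mulr_le0_ge0 // subr_le0 lern1.
have x0 : 0 < x%:R :> R by rewrite ltr0n; lia.
have h : x.-1%:R * ln 2 <= (size (primes_in 0 x)).+1%:R * ln x%:R :> R.
  rewrite [leLHS]mulr_natl [leRHS]mulr_natl -!lnXn // ler_ln ?posrE ?exprn_gt0 //.
  by rewrite -!natrX ler_nat size_primes_ge.
have -> : x%:R - 1 = x.-1%:R :> R by rewrite -[in LHS](prednK (ltnW x2)) -natr1 addrK.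
apply: le_trans h _; rewrite natr1 ler_wpM2l // ler_ln ?posrE ?ler_nat // ltr0n //.
Qed.

(** For each p the Chebyshev lower bound is applied at (n - 1) / p. At most z primes are lost below
    z, and 4 covers the rounding because ln n >= 1 and ln 2 <= 3/4. *)
Lemma size_semiprime_list_ge (R : realType) n z w : (0 < n)%N -> 1 <= ln n%:R :> R ->
  n%:R * ln 2 / ln n%:R * recip_sum R (primes_in 0 w) - w%:R * (z%:R + 4) <=
    (size (semiprime_list n z w))%:R.
Proof.
move=> n0 l1; have l0 : 0 < ln n%:R :> R by apply: lt_le_trans l1.
rewrite size_semiprime_list natr_sum.
apply: (@le_trans _ _ (\sum_(p <- primes_in 0 w)
   (n%:R * ln 2 / ln n%:R * p%:R^-1 - (z%:R + 4)))).
  rewrite sumrB -big_distrr /= lerD2l lerN2 big_const_seq count_predT iter_addr_0.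
  rewrite -[leLHS]mulr_natl ler_wpM2r ?addr_ge0 // ler_nat.
  by have := size_primes_in 0 w; rewrite subn0.
rewrite big_seq [leRHS]big_seq; apply: ler_sum => p.
rewrite mem_primes_in => /and3P[p0 _ _]; set x := (n.-1 %/ p)%N.
have xn : (x <= n)%N by apply: leq_trans (leq_div _ _) _; exact: leq_pred.
have p0' : 0 < p%:R :> R by rewrite ltr0n.
have hz : (size (primes_in 0 x))%:R - z%:R <= (size (primes_in z x))%:R :> R.
  rewrite lerBlDr -natrD ler_nat; case: (leqP z x) => zx.
    by rewrite (@primes_in_cat 0 z x) // size_cat addnC leq_add2l; have := size_primes_in 0 z; rewrite subn0.
  by apply: leq_trans (size_primes_in 0 x) _; lia.
have hx : n%:R / p%:R - 2 <= x%:R :> R.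
  rewrite lerBlDr ler_pdivrMr // -[2]/(2%:R) -natrD -natrM ler_nat.
  by have := ltn_ceil n.-1 p0; rewrite -/x; nia.
have h := size_primes_real R n0 xn.
have l2 : 0 <= ln 2 :> R by rewrite ln_ge0 // ler1n.
have l23 := ln2_le R.
apply: le_trans hz; rewrite -(lerD2r (z%:R + 4)) subrK.
have -> : n%:R * ln 2 / ln n%:R * p%:R^-1 = n%:R / p%:R * ln 2 / ln n%:R :> R.
  by rewrite mulrAC (mulrAC n%:R).
rewrite ler_pdivrMr //.
move: (n%:R / p%:R) (size _)%:R x%:R (ln n%:R) (ln 2) h hx l1 l0 l2 l23 => a b d e f h hx l1 l0 l2 l23.
nra.
Qed.

Lemma semiprime_cpx_ge_list (R : realType) n z w : Dickson_conjecture ->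
  (0 < n)%N -> (w <= z)%N ->
  exists2 t : nat, (2 ^ t <= cpx (indicator semiprimes) n)%N &
    (size (semiprime_list n z w))%:R * (1 - recip_sum R (primes_in z n)) <= t%:R.
Proof.
move=> dickson n0 wz.
pose T0 := [set i : 'I_n | val i \in semiprime_list n z w]%SET.
have cT0 : #|T0| = size (semiprime_list n z w).
  rewrite (card_ord_count n (fun i => i \in semiprime_list n z w)) -size_filter.
  apply/perm_size/uniq_perm; [exact/filter_uniq/iota_uniq|exact: semiprime_list_uniq|].
  move=> i; rewrite mem_filter mem_iota andb_idr // => /mem_semiprime_list.
  by case/(_ n0 wz).
have [T [TT0 HT cT]] := avoid_classes R T0 (@primes_in_prime z n).
exists #|T|; last by rewrite -cT0.
apply: (@semiprime_cpx_ge n z T dickson).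
  move=> i /(fintype.subsetP TT0); rewrite finset.in_set => /mem_semiprime_list.
  by case/(_ n0 wz).
move=> q qp zq; have [qn|nq] := leqP q n; first by apply: HT; rewrite mem_primes_in zq qn.
(* For q > n the residue n itself is missed by all positions i < n. *)
exists n => i _; rewrite !modn_small ?(ltn_trans (ltn_ord i)) // => E.
by have := ltn_ord i; rewrite E ltnn.
Qed.

(** * Choice of parameters and the asymptotic lower bound *)

(** There are 2h + 1 dyadic blocks, each contributing at most 2 / (K - 2h). The bound 1/8 amounts to
    34h + 16 <= K, which follows from 40h <= K and K >= 107. *)
Lemma recip_sum_top_le (R : realType) K h n : (107 <= K)%N -> (40 * h <= K)%N ->
  (n <= 2 ^ K.+1)%N -> recip_sum R (primes_in (2 ^ (K - 2 * h)) n) <= 8^-1.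
Proof.
move=> K0 hK nK; set a := (K - 2 * h)%N.
have a0 : (0 < a)%N by rewrite /a; lia.
have aK : (a <= K.+1)%N by rewrite /a; lia.
apply: (@le_trans _ _ (recip_sum R (primes_in (2 ^ a) (2 ^ K.+1)))).
  case: (leqP (2 ^ a) n) => an.
    by rewrite (@primes_in_cat (2 ^ a) n (2 ^ K.+1)) // recip_sum_cat lerDl recip_sum_ge0.
  have -> : primes_in (2 ^ a) n = [::].
    by apply: size0nil; have := size_primes_in (2 ^ a) n; lia.
  by rewrite {1}/recip_sum big_nil recip_sum_ge0.
apply: le_trans (recip_sum_dyadic R a0 aK) _.
apply: (@le_trans _ _ (\sum_(a <= k < K.+1) 2 / a%:R)).
  rewrite big_nat [leRHS]big_nat; apply: ler_sum => k /andP[ak _].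
  by rewrite ler_wpM2l // lef_pV2 ?posrE ?ltr0n ?ler_nat // (leq_trans a0).
rewrite sumr_const_nat -[leLHS]mulr_natl mulrA ler_pdivrMr ?ltr0n //.
rewrite ler_pdivlMl // -!natrM ler_nat /a; lia.
Qed.

Lemma semiprime_cpx_lower (R : realType) (n : nat) (L x : R) : Dickson_conjecture ->
  200 <= L -> x = expR L -> n%:R = expR x -> ln n%:R = x ->
  expR (ln 2 * (n%:R * L / (2 * x))) <= (cpx (indicator semiprimes) n)%:R.
Proof.
move=> dickson L0 xE nE lnE.
have x3 : L ^+ 3 / 6 <= x by rewrite xE; apply: expR_ge_cube; lra.
have L2 : 200 * L <= L ^+ 2 by rewrite expr2 ler_wpM2r //; lra.
have L3 : 200 * L ^+ 2 <= L ^+ 3 by rewrite exprS ler_wpM2r ?sqr_ge0.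
have x0 : 80 * 100 <= x by lra.
have n1 : (1 < n)%N by rewrite -(ltr_nat R) nE -[ltLHS]expR0 ltr_expR; lra.
have n0 : (0 < n)%N by exact: ltnW.
have n0' : 0 < n%:R :> R by rewrite ltr0n.
have [K Kn nK] : exists2 K, (2 ^ K <= n)%N & (n < 2 ^ K.+1)%N.
  by exists (trunc_log 2 n); [exact: trunc_logP | exact: trunc_log_ltn].
have [h hK Kh'] : exists2 h, (40 * h <= K)%N & (K <= 40 * h + 40)%N.
  by exists (K %/ 40)%N; lia.
have hz : (h <= K - 2 * h)%N by lia.
have hwz : (h + (K - 2 * h) + h <= K)%N by lia.
have l2 := ln2_ge R; have l2' := ln2_le R.
have xK : x <= (K%:R + 1) * ln 2.
  rewrite -lnE natr1 mulr_natl -lnXn // ler_ln ?posrE ?exprn_gt0 // -natrX ler_nat ltnW //.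
have K0 : 200 <= K%:R :> R.
  have : 0 <= K%:R :> R by []. nra.
have K107 : (107 <= K)%N by rewrite -(ler_nat R); lra.
have Kh : K%:R <= 40 * h%:R + 40 :> R. by rewrite -natrM -natrD ler_nat.
(* 64 is a power of 2 above 40, so ln(x / 64) is L - 6 ln 2, which fits into the bound L - 7
   below. *)
have hx : x / 64 <= h%:R * ln 2.
  have : x <= (40 * h%:R + 41) * ln 2.
    apply: le_trans xK _; rewrite ler_wpM2r //; lra.
  by move: (h%:R) => t; lra.
have whE : (2 ^ h)%:R = expR (h%:R * ln 2) :> R.
  by rewrite natrX expRM_natl lnK ?posrE.
have wx : 5 * x <= (2 ^ h)%:R.
  rewrite whE; apply: (@le_trans _ _ (expR (x / 64))); last by rewrite ler_expR.
  set u := x / 64; have u0 : 100 <= u by rewrite /u; lra.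
  have -> : 5 * x = 320 * u by rewrite /u; field.
  apply: le_trans (@expR_ge_cube R u _); last lra.
  have u2 : 100 * u <= u ^+ 2 by rewrite expr2 ler_wpM2r //; lra.
  have u3 : 100 * u ^+ 2 <= u ^+ 3 by rewrite exprS ler_wpM2r ?sqr_ge0.
  by lra.
(* The exponents give w z w <= n; the spare factor w >= 5x makes the error w (z + 4) at most n /
   x. *)
pose w := (2 ^ h)%N; pose z := (2 ^ (K - 2 * h))%N.
have wz : (w <= z)%N by rewrite leq_exp2l.
have [t tc tge] := semiprime_cpx_ge_list R dickson n0 wz.
apply: (@le_trans _ _ ((2 ^ t)%:R)); last by rewrite ler_nat.
rewrite natrX -[2%:R in leRHS]lnK ?posrE // -expRM_natl ler_expR mulrC.
rewrite ler_wpM2r //; first lra.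
apply: le_trans tge.
have r8 := recip_sum_top_le R K107 hK (ltnW nK); rewrite -/z in r8.
have rw : L - 7 <= recip_sum R (primes_in 0 w).
  have w2 : (2 <= w)%N by rewrite -(ler_nat R) /w; lra.
  apply: le_trans (recip_sum_primes_ge R w2).
  have : ln (x / 64) <= ln (ln w.+1%:R).
    have hw : x / 64 <= ln w.+1%:R.
      apply: le_trans hx _; rewrite -[leLHS]expRK -whE ler_ln ?posrE ?ltr0n ?expn_gt0 //.
      by rewrite ler_nat.
    by rewrite ler_ln ?posrE //; lra.
  have -> : ln (x / 64) = L - 6 * ln 2.
    rewrite ln_div ?posrE //; [|lra]. rewrite xE expRK.
    have -> : 64 = 2 ^+ 6 :> R by ring.
    by rewrite lnXn // mulr_natl.
  by lra.
have lge := size_semiprime_list_ge (R := R) z w n0.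
rewrite lnE in lge; have x1 : 1 <= x by lra.
have {}lge := lge x1.
have err : w%:R * (z%:R + 4) <= n%:R / x :> R.
  rewrite ler_pdivlMr; last lra.
  apply: (@le_trans _ _ (w%:R * z%:R * (5 * x))).
    have z1 : 1 <= z%:R :> R by rewrite ler1n expn_gt0.
    have w0 : 0 <= w%:R * x by rewrite mulr_ge0 //; lra.
    have -> : w%:R * z%:R * (5 * x) = w%:R * x * (5 * z%:R) by ring.
    have -> : w%:R * (z%:R + 4) * x = w%:R * x * (z%:R + 4) by ring.
    by rewrite ler_wpM2l //; lra.
  apply: (@le_trans _ _ (w%:R * z%:R * w%:R)); first by rewrite ler_wpM2l.
  rewrite -!natrM ler_nat; apply: leq_trans Kn; rewrite -!expnD leq_exp2l //.
have nx : 0 < n%:R / x by rewrite divr_gt0 //; lra.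
set S := recip_sum R _ in rw lge; set e := recip_sum R _ in r8 *.
set N := (size _)%:R in lge *.
have N0 : 0 <= N by [].
apply: (@le_trans _ _ (N * (7 / 8))); last by rewrite ler_wpM2l //; lra.
have -> : n%:R * L / (2 * x) = n%:R / x * (L / 2) by field; lra.
have SN : n%:R / x * (ln 2 * S - 1) <= N.
  have -> : n%:R / x * (ln 2 * S - 1) = n%:R * ln 2 / x * S - n%:R / x by field; lra.
  by lra.
(* 3/5 times 7/8 is 21/40, and its excess over 1/2 absorbs the constants as soon as L >= 182. *)
have LS : L / 2 <= (ln 2 * S - 1) * (7 / 8).
  have : 3 / 5 * (L - 7) <= ln 2 * S by apply: ler_pM; lra.
  by lra.
apply: le_trans (_ : n%:R / x * ((ln 2 * S - 1) * (7 / 8)) <= _).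
  by rewrite ler_wpM2l // ltW.
by rewrite mulrA ler_wpM2r //; lra.
Qed.

Lemma semiprime_cpx_oexp_ge (R : realType) : Dickson_conjecture ->
  oexp_ll 2 (fun n : nat => n%:R * ln (ln n%:R) / (2 * ln n%:R))
    (fun n : nat => (cpx (indicator semiprimes) n)%:R : R).
Proof.
move=> dickson; exists 1; first exact: ltr01.
exists (fun=> 0); first exact: cvg_cst.
near=> n.
have [L [x [L0 xE nE lnE lnx]]] : exists L x : R,
  [/\ 200 <= L, x = expR L, n%:R = expR x, ln n%:R = x & ln x = L].
  by near: n; exact: near_lnln.
rewrite mul1r addr0 -[X in X `^ _]lnK ?posrE // -expRM lnE lnx.
exact: semiprime_cpx_lower.
Unshelve. all: by end_near. Qed.

Theorem theorem1p2 (R : realType) :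
  ll_oexp (fun n : nat => (cpx (indicator semiprimes) n)%:R : R) 4
    (fun n : nat => 23 * n%:R * (ln (ln n%:R)) ^+ 2 / (ln 4 * ln n%:R))
  /\
  (Dickson_conjecture ->
   oexp_ll 2 (fun n : nat => n%:R * ln (ln n%:R) / (2 * ln n%:R))
     (fun n : nat => (cpx (indicator semiprimes) n)%:R : R)).
Proof.
by split; [exact: semiprime_cpx_upper | exact: semiprime_cpx_oexp_ge].
Qed.
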